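(* Let $d\ge 2$, and for $m\ge0$ let $p_m,q_m$ be the biorthogonal functions, whose definition depends on the parity of $d$ ($d=2n$ or $d=2n+1$). (i) For $d=2n$, $p_m(x)$ is a polynomial in $x^2$; for $d=2n+1$, $p_m(x)/x$ is a polynomial in $x^2$. Moreover $$ x^2p_m(x)=\sum_{k=0}^{m+1}\alpha_{k,m}\,p_{m+1-k}(x), $$ where $\alpha_{0,m}=1$, $$ \alpha_{1,m}=\left(\frac\pi2\right)^2\begin{cases}4m+1,& d=2n\\4m+3,& d=2n+1\end{cases},\qquad \alpha_{k,m}=\left(\frac\pi2\right)^{2k}2T_{k-1}\begin{cases}\binom{2m+1}{2(m+1-k)},& d=2n\\ \binom{2m+2}{2(m+1-k)+1},& d=2n+1\end{cases}\quad(2\le k\le m+1). $$ (ii) For $d=2n$, $q_m(x)/\operatorname{sech}(x)$ is a polynomial in $\operatorname{sech}(x)^2$; for $d=2n+1$, $q_m(x)/(\operatorname{sech}(x)\tanh(x))$ is a polynomial in $\operatorname{sech}(x)^2$. Moreover $$ \operatorname{sech}(x)^2q_m(x)=\sum_{k=0}^{m+1}(-1)^{k-1}\beta_{k,m}\,q_{m+1-k}(x), $$ where $0\le\beta_{k,m}\le1$ and $$ \beta_{0,m}=1,\qquad \beta_{k,m}=\frac{2(2k-1)}{\pi^{2k}}\zeta(2k)\quad(1\le k\le m), $$ $$ \beta_{m+1,m}=\frac{4\zeta(2m+2)}{\pi^{2m+2}}\begin{cases}(2m+1)(1-2^{-2m-2}),& d=2n\\ m+2^{-2m-2},& d=2n+1.\end{cases}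 $$
   Context: The biorthogonal functions are $$ p_m(x)=\begin{cases}\operatorname{Re}\left[\left(x+i\frac{\pi}{2}\right)^{2m}\right],& d=2n\\ \operatorname{Re}\left[\left(x+i\frac{\pi}{2}\right)^{2m+1}\right],& d=2n+1\end{cases},\qquad q_m(x)=\frac2\pi\begin{cases}\frac{1}{(2m)!}\operatorname{sech}^{(2m)}(x),& d=2n\\ \frac{-1}{(2m+1)!}\operatorname{sech}^{(2m+1)}(x),& d=2n+1.\end{cases} $$ $\zeta$ is the Riemann zeta function and $T_m=2\left(\frac2\pi\right)^{2m+2}(2m+1)!\,(1-2^{-(2m+2)})\,\zeta(2m+2)$, $m\ge0$, are the tangent numbers, i.e. $\tan x=\sum_{m\ge0}T_m\frac{x^{2m+1}}{(2m+1)!}$. *)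

(* Defs.v *)
From mathcomp Require Import all_boot all_order all_algebra.
From mathcomp Require Import complex.
From mathcomp Require Import all_classical all_reals all_analysis.
Set Implicit Arguments.
Unset Strict Implicit.
Unset Printing Implicit Defensive.
Import Order.TTheory GRing.Theory Num.Theory.
Import numFieldNormedType.Exports.
Local Open Scope classical_set_scope.
Local Open Scope ring_scope.

(* The case [d = 2n] is [odd d = false], the case [d = 2n + 1] is
   [odd d = true]. *)

Definition sech {R : realType} (x : R) : R := 2 / (expR x + expR (- x)).

Definition tanh {R : realType} (x : R) : R :=
  (expR x - expR (- x)) / (expR x + expR (- x)).

Definition p {R : realType} (d m : nat) (x : R) : R :=
  let z : R[i] := (x +i* (pi / 2))%C in
  if odd d then complex.Re (z ^+ (2 * m).+1) else complex.Re (z ^+ (2 * m)).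

Definition q {R : realType} (d m : nat) (x : R) : R :=
  2 / pi *
  (if odd d then (- 1) / ((2 * m).+1)`!%:R * derive1n (2 * m).+1 sech x
   else 1 / (2 * m)`!%:R * derive1n (2 * m) sech x).

(* Dirichlet series of the Riemann zeta function; meaningful for [1 < s]. *)
Definition zeta {R : realType} (s : R) : R :=
  limn (series (fun n : nat => (n.+1%:R : R) `^ (- s))).

Definition tangent_number {R : realType} (m : nat) : R :=
  2 * (2 / pi) ^+ (2 * m + 2) * ((2 * m).+1)`!%:R
  * (1 - 2 ^- (2 * m + 2)) * zeta (2 * m + 2)%:R.

(* Only used for [k <= m.+1], so the natural-number subtraction is exact. *)
Definition alpha {R : realType} (d k m : nat) : R :=
  match k with
  | 0 => 1
  | 1 => (pi / 2) ^+ 2 * (if odd d then 4 * m + 3 else 4 * m + 1)%N%:R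
  | _ => (pi / 2) ^+ (2 * k) * (2 * tangent_number k.-1)
         * (if odd d then 'C(2 * m + 2, 2 * (m.+1 - k) + 1)
            else 'C(2 * m + 1, 2 * (m.+1 - k)))%:R
  end.

(* Only used for [k <= m.+1]. *)
Definition beta {R : realType} (d k m : nat) : R :=
  if k == 0%N then 1
  else if (k <= m)%N then
    2 * (2 * k%:R - 1) / pi ^+ (2 * k) * zeta (2 * k)%:R
  else
    4 * zeta (2 * m + 2)%:R / pi ^+ (2 * m + 2)
    * (if odd d then m%:R + 2 ^- (2 * m + 2)
       else (2 * m%:R + 1) * (1 - 2 ^- (2 * m + 2))).

(* Main.v *)
Require Import Defs.
From HB Require Import structures.
From mathcomp Require Import all_boot all_order all_algebra.
From mathcomp Require Import complex ring lra zify.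
From mathcomp Require Import all_classical all_reals all_analysis.
Import Order.TTheory GRing.Theory Num.Theory.
Import numFieldNormedType.Exports.
Set Implicit Arguments.
Unset Strict Implicit.
Unset Printing Implicit Defensive.
Local Open Scope ring_scope.

(**
Both recurrences are coefficient comparisons in identities between formal
power series in an auxiliary variable [t].

For [p], let [a = pi / 2] and [F = exp (x t) cos (a t)], whose coefficient of
degree [j] is [Re ((x + i a)^j) / j!]. Since
[tan (a t) F = exp (x t) sin (a t)], one has
[x^2 F = F'' + 2 a (tan (a t) F)' - a^2 F] ([fps_exp_cos_eq]). The tangent
series is odd, so the coefficient of degree [j] only involves the degrees
[j + 2 - 2 k], and [j = 2 m], [j = 2 m + 1] give the two parities at once
([sqr_Re_expr]).

For [q], let [u] be the Taylor series in [t] of [sech (x + t)]. From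
[cosh (x + t) cosh (x - t) = cosh^2 x + sinh^2 t] follows
[(sech^2 x + 1 / sinh^2 t) u = sech x cosh t / sinh^2 t + sech' x / sinh t]
([fps_sech_eq]), the even part of which is the recurrence for even [d] and the
odd part the one for odd [d]. The coefficients of [1 / sinh^2 t],
[cosh t / sinh^2 t] and [1 / sinh t] come from those of [coth t], through
[1 / sinh^2 = - coth'], [cosh / sinh^2 = - (1 / sinh)'] and
[1 / sinh t = coth (t / 2) - coth t]; those of [coth t] come from those of
[tanh t] through [2 coth (2 t) = coth t + tanh t].

It remains to express the coefficients of the tangent with zeta values. Let
[lambda k] be the sum of [1 / w^(2 k)] over the odd numbers [w > 0], that is
[(1 - 4^-k) zeta (2 k)]. The equation [tan' = 1 + tan^2] says that
[2 (2 / pi)^(2 k) lambda k] is the coefficient of degree [2 k - 1] as soon as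
[lambda 1 = pi^2 / 8] and
[sum_(i + j = k, i, j > 0) lambda i * lambda j = (k - 1/2) lambda k] for
[k >= 2] ([tan_coef_recurrence]). The first equality ([odd_zeta1]) follows
from repeated angle halving in [1 / sin^2] and the bounds
[1 / x^2 <= 1 / sin^2 x <= 1 + 1 / x^2]. For the second ([odd_zeta_conv]), the
left side, with the sums truncated at the odd numbers below [2 N], is a double
sum over pairs [(w, w')] of a finite geometric sum in [i]; summing the
geometric sums for [w <> w'] leaves sums of [1 / (w'^2 - w^2)], which telescope
up to an error of order [1 / N]. The bounds on [beta] use
[zeta (2 k) <= zeta 2 = pi^2 / 6] and [pi >= 2].

The polynomial forms follow by induction on [m]: the real part of
[(x + i a)^(2 m)] and the quotient by [x] of its imaginary part are polynomials
in [x^2], and differentiation exchanges the functions [sech * P (sech^2)] and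
[sech * tanh * P (sech^2)] with [P] polynomial.
*)

(** * Formal power series *)

(** A formal power series is its sequence of coefficients: [f n] is the
    coefficient of degree [n]. *)
Definition fps (K : Type) : Type := nat -> K.

HB.instance Definition _ (K : comNzRingType) :=
  GRing.Zmodule.copy (fps K) (nat -> K).

Section FpsRing.
Variable K : comNzRingType.
Implicit Types f g h : fps K.

(** Addition is pointwise, multiplication is the Cauchy product. *)
Definition fps_one : fps K := fun n => (n == 0%N)%:R.
Definition fps_mul f g : fps K := fun n => \sum_(i < n.+1) f i * g (n - i)%N.

(** The polynomial of degree less than [N] that agrees with [f] up to degree
    [N - 1]; it transfers polynomial identities to power series. *)
Definition fps_trunc N f : {poly K} := \poly_(i < N) f i.

Lemma coef_fps_trunc N f n : (n < N)%N -> (fps_trunc N f)`_n = f n.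
Proof. by rewrite coef_poly => ->. Qed.

Lemma fps_mul_trunc N f g n : (n < N)%N ->
  fps_mul f g n = (fps_trunc N f * fps_trunc N g)`_n.
Proof.
move=> ltnN; rewrite coefM; apply: eq_bigr => i _.
rewrite !coef_fps_trunc //; first exact: leq_ltn_trans (leq_subr _ _) ltnN.
by apply: leq_ltn_trans ltnN; rewrite -ltnS.
Qed.

(** The coefficient of degree [n] of a product only depends on the
    coefficients of degree at most [n] of the factors. *)
Lemma coefM_eq (P P' Q Q' : {poly K}) n :
  (forall i, (i <= n)%N -> P`_i = P'`_i) ->
  (forall i, (i <= n)%N -> Q`_i = Q'`_i) -> (P * Q)`_n = (P' * Q')`_n.
Proof.
move=> eqP eqQ; rewrite !coefM; apply: eq_bigr => i _.
by rewrite eqP -1?ltnS // eqQ // leq_subr.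
Qed.

Lemma fps_mulA : associative fps_mul.
Proof.
move=> f g h; apply/funext => n.
rewrite !(fps_mul_trunc _ _ (ltnSn n)).
transitivity
  ((fps_trunc n.+1 f * (fps_trunc n.+1 g * fps_trunc n.+1 h))`_n).
  apply: coefM_eq => // i lein.
  by rewrite coef_fps_trunc ?ltnS // (fps_mul_trunc (N := n.+1)).
rewrite mulrA; apply: coefM_eq => // i lein.
by rewrite coef_fps_trunc ?ltnS // (fps_mul_trunc (N := n.+1)).
Qed.

Lemma fps_mulC : commutative fps_mul.
Proof.
by move=> f g; apply/funext => n; rewrite !(fps_mul_trunc _ _ (ltnSn n)) mulrC.
Qed.

Lemma fps_mul1 : left_id fps_one fps_mul.
Proof.
move=> f; apply/funext => n; rewrite /fps_mul big_ord_recl /fps_one eqxx mul1r.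
by rewrite subn0 big1 ?addr0 // => i _; rewrite mul0r.
Qed.

Lemma fps_mulDl : left_distributive fps_mul +%R.
Proof.
move=> f g h; apply/funext => n; transitivity (fps_mul f h n + fps_mul g h n).
  by rewrite /fps_mul -big_split; apply: eq_bigr => i _; exact: mulrDl.
by [].
Qed.

Lemma fps_one_neq0 : fps_one != 0 :> fps K.
Proof. by apply/eqP => /(congr1 (fun f => f 0%N))/eqP; rewrite oner_eq0. Qed.

HB.instance Definition _ := GRing.Zmodule_isComNzRing.Build (fps K)
  fps_mulA fps_mulC fps_mul1 fps_mulDl fps_one_neq0.

(** Constants, the indeterminate, formal derivation, and the substitution of
    [c * t] for the indeterminate [t]. *)
Definition fpsC (c : K) : fps K := fun n => if n is 0 then c else 0.
Definition fpsX : fps K := fun n => (n == 1%N)%:R.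
Definition fpsD f : fps K := fun n => n.+1%:R * f n.+1.
Definition fps_scale c f : fps K := fun n => c ^+ n * f n.

Lemma fpsP f g : (forall n, f n = g n) -> f = g.
Proof. by move=> fg; apply/funext. Qed.

Lemma fps1E n : (1 : fps K) n = (n == 0%N)%:R. Proof. by []. Qed.

Lemma fpsDE f g n : (f + g) n = f n + g n. Proof. by []. Qed.

Lemma fpsNE f n : (- f) n = - f n. Proof. by []. Qed.

Lemma fpsME f g n : (f * g) n = \sum_(i < n.+1) f i * g (n - i)%N.
Proof. by []. Qed.

Lemma fpsM0E f g : (f * g) 0%N = f 0%N * g 0%N.
Proof. by rewrite fpsME big_ord1. Qed.

Lemma fpsCME c f n : (fpsC c * f) n = c * f n.
Proof.
rewrite fpsME big_ord_recl subn0 big1 ?addr0 // => i _.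
by rewrite /fpsC /= mul0r.
Qed.

Lemma fpsXM0E f : (fpsX * f) 0%N = 0.
Proof. by rewrite fpsM0E /fpsX /= mul0r. Qed.

Lemma fpsXMSE f n : (fpsX * f) n.+1 = f n.
Proof.
rewrite fpsME 2!big_ord_recl /fpsX /= mul0r add0r mul1r subSS subn0.
by rewrite big1 ?addr0 // => i _; rewrite mul0r.
Qed.

Lemma fpsX_inj f g : fpsX * f = fpsX * g -> f = g.
Proof. by move=> fg; apply: fpsP => n; rewrite -fpsXMSE fg fpsXMSE. Qed.

Lemma fpsC1 : fpsC 1 = 1. Proof. by apply: fpsP => -[]. Qed.

Lemma fpsCN1 : fpsC (-1) = -1.
Proof. by apply: fpsP => -[|n]; rewrite fpsNE //= oppr0. Qed.

Lemma fpsC2 : fpsC 2 = 1 + 1.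
Proof. by apply: fpsP => -[|n]; rewrite fpsDE //= addr0. Qed.

Lemma fpsCB c d : fpsC (c - d) = fpsC c - fpsC d.
Proof. by apply: fpsP => -[|n] //=; rewrite fpsDE fpsNE /fpsC /= subr0. Qed.

Lemma fpsCM c d : fpsC (c * d) = fpsC c * fpsC d.
Proof. by apply: fpsP => -[|n]; rewrite fpsCME //= mulr0. Qed.

Lemma fpsDD f g : fpsD (f + g) = fpsD f + fpsD g.
Proof. by apply: fpsP => n; rewrite [LHS]mulrDr. Qed.

Lemma fpsDN f : fpsD (- f) = - fpsD f.
Proof. by apply: fpsP => n; rewrite [LHS]mulrN. Qed.

Lemma fpsD1 : fpsD 1 = 0.
Proof. by apply: fpsP => n; rewrite [LHS]mulr0. Qed.

Lemma fpsDC c : fpsD (fpsC c) = 0.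
Proof. by apply: fpsP => n; rewrite [LHS]mulr0. Qed.

Lemma fpsDX : fpsD fpsX = 1.
Proof.
by apply: fpsP => -[|n]; rewrite /fpsD /fpsX /= ?mulr0 // mul1r.
Qed.

Lemma fpsDM f g : fpsD (f * g) = fpsD f * g + f * fpsD g.
Proof.
apply: fpsP => n.
have TE h i : (i <= n)%N -> (fps_trunc n.+1 h)`_i = (fps_trunc n.+2 h)`_i.
  by move=> lein; rewrite !coef_fps_trunc // ltnS ltnW.
have DE h i : (i <= n)%N ->
    (fps_trunc n.+1 (fpsD h))`_i = (fps_trunc n.+2 h)^`()`_i.
  by move=> lein; rewrite coef_deriv !coef_fps_trunc // [LHS]mulr_natl.
rewrite fpsDE [LHS]mulr_natl [(f * g) n.+1](fps_mul_trunc (N := n.+2)) //.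
rewrite -coef_deriv derivM coefD.
rewrite [(fpsD f * g) n](fps_mul_trunc (N := n.+1)) //.
rewrite [(f * fpsD g) n](fps_mul_trunc (N := n.+1)) //.
congr (_ + _); apply: coefM_eq => i lein; symmetry.
- exact: DE.
- exact: TE.
- exact: TE.
- exact: DE.
Qed.

Lemma fpsDscale c f : fpsD (fps_scale c f) = fpsC c * fps_scale c (fpsD f).
Proof.
by apply: fpsP => n; rewrite fpsCME /fpsD /fps_scale exprS; ring.
Qed.

Lemma fps_scaleD c f g : fps_scale c (f + g) = fps_scale c f + fps_scale c g.
Proof. by apply: fpsP => n; rewrite [LHS]mulrDr. Qed.

Lemma fps_scaleN c f : fps_scale c (- f) = - fps_scale c f.
Proof. by apply: fpsP => n; rewrite [LHS]mulrN. Qed.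

Lemma fps_scale1 c : fps_scale c 1 = 1.
Proof.
by apply: fpsP => -[|n]; rewrite /fps_scale ?mul1r // !fps1E mulr0.
Qed.

Lemma fps_scaleX c : fps_scale c fpsX = fpsC c * fpsX.
Proof.
by apply: fpsP => -[|[|n]]; rewrite fpsCME /fps_scale /fpsX /= ?mulr0.
Qed.

Lemma fps_scaleC c d : fps_scale c (fpsC d) = fpsC d.
Proof. by apply: fpsP => -[|n]; rewrite /fps_scale ?mul1r //= mulr0. Qed.

Lemma fps_scaleM c f g : fps_scale c (f * g) = fps_scale c f * fps_scale c g.
Proof.
apply: fpsP => n; rewrite /fps_scale !fpsME mulr_sumr; apply: eq_bigr => i _.
by rewrite mulrACA -exprD subnKC // -ltnS.
Qed.

Lemma fps_scaleA c d f : fps_scale c (fps_scale d f) = fps_scale (c * d) f.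
Proof. by apply: fpsP => n; rewrite /fps_scale exprMn mulrA. Qed.

(** Odd and even series. *)
Definition fps_odd f := forall n, ~~ odd n -> f n = 0.

Definition fps_even f := forall n, odd n -> f n = 0.

(** Coefficients of a product whose first factor is even: only the even
    indices contribute. *)
Lemma fps_evenME f g n : fps_even f ->
  (f * g) n = \sum_(0 <= k < n./2.+1) f (2 * k)%N * g (n - 2 * k)%N.
Proof.
move=> f0; rewrite fpsME -(big_mkord xpredT (fun i => f i * g (n - i)%N)).
suff E (h : nat -> K) N : \sum_(0 <= i < N.+1) f i * h i =
    \sum_(0 <= k < N./2.+1) f (2 * k)%N * h (2 * k)%N by exact: E.
elim: N => [|N IHN]; first by rewrite !big_nat1.
rewrite big_nat_recr //= IHN uphalf_half.
have [oN|eN] := boolP (odd N); last by rewrite add0n f0 ?mul0r ?addr0 //= eN.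
rewrite add1n [in RHS]big_nat_recr //=.
suff -> : (2 * (N./2).+1 = N.+1)%N by [].
by rewrite -[in RHS](odd_double_half N) oN mul2n doubleS.
Qed.

Lemma fps_oddME f g n : fps_odd f ->
  (f * g) n.+1 = \sum_(0 <= k < n./2.+1) f (2 * k).+1 * g (n - 2 * k)%N.
Proof.
move=> f0; pose h : fps K := fun i => f i.+1.
have fE : f = fpsX * h.
  by apply: fpsP => -[|i]; [rewrite fpsXM0E f0 | rewrite fpsXMSE].
have h0 : fps_even h by move=> i oi; rewrite /h f0 //= negbK.
by rewrite {1}fE -mulrA fpsXMSE fps_evenME.
Qed.

End FpsRing.

Arguments fpsX {K}.
Arguments fpsC1 {K}.
Arguments fpsC2 {K}.
Arguments fpsCN1 {K}.

(** A series with nonzero constant coefficient can be cancelled. *)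
Lemma fps_regular (K : numFieldType) (f g h : fps K) :
  f 0%N != 0 -> f * g = f * h -> g = h.
Proof.
move=> f0 fgh; apply: fpsP => n; elim/ltn_ind: n => n IHn.
move/(congr1 (fun u : fps K => u n)): fgh; rewrite !fpsME.
rewrite 2!big_ord_recl /= subn0.
have -> : \sum_(i < n) f (bump 0 i) * g (n - bump 0 i)%N =
          \sum_(i < n) f (bump 0 i) * h (n - bump 0 i)%N.
  apply: eq_bigr => i _; rewrite IHn // /bump /= add1n.
  by rewrite ltn_subrL (leq_ltn_trans _ (ltn_ord i)).
by move/addIr/(mulfI f0).
Qed.

(** A linear differential equation of order one with vanishing initial value
    has only the zero solution. *)
Lemma fps_ode_eq0 (K : numFieldType) (f u : fps K) :
  fpsD u = f * u -> u 0%N = 0 -> u = 0.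
Proof.
move=> Du u0; apply: fpsP => n; elim/ltn_ind: n => -[_|n IHn] //.
have := congr1 (fun v : fps K => v n) Du; rewrite fpsME big1.
  by move/eqP; rewrite mulf_eq0 pnatr_eq0 /= => /eqP.
by move=> i _; rewrite IHn ?ltnS ?leq_subr // mulr0.
Qed.

(** * Formal exponential, circular and hyperbolic series *)

Section FormalTrigonometry.
Variable K : numFieldType.
Implicit Types (e c x a : K) (t : nat -> K).

(** The series of [exp (x t)]. *)
Definition fps_exp x : fps K := fun n => x ^+ n / n`!%:R.

(** Cosine and sine series, circular for [e = -1] and hyperbolic for
    [e = 1]: [y'' = e * y] in both cases. *)
Definition fps_cos e : fps K :=
  fun n => if odd n then 0 else e ^+ n./2 / n`!%:R.
Definition fps_sin e : fps K :=
  fun n => if odd n then e ^+ n./2 / n`!%:R else 0.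

(** The series [sinh t / t]. *)
Definition fps_sinhc : fps K := fun n => if odd n then 0 else (n.+1`!%:R)^-1.

Lemma fact_neq0 n : n`!%:R != 0 :> K.
Proof. by rewrite pnatr_eq0 -lt0n fact_gt0. Qed.

Lemma fact_invS n : n.+1%:R * (n.+1`!%:R)^-1 = (n`!%:R)^-1 :> K.
Proof.
rewrite factS natrM invfM mulrA mulfV ?mul1r //.
Qed.

Lemma fpsD_exp x : fpsD (fps_exp x) = fpsC x * fps_exp x.
Proof.
apply: fpsP => n; rewrite fpsCME /fpsD /fps_exp -(fact_invS n) exprS.
by rewrite mulrCA !mulrA.
Qed.

Lemma fpsD_cos e : fpsD (fps_cos e) = fpsC e * fps_sin e.
Proof.
apply: fpsP => n; rewrite fpsCME /fpsD /fps_cos /fps_sin /= uphalf_half.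
case: (odd n); last by rewrite !mulr0.
by rewrite -(fact_invS n) add1n exprS mulrCA !mulrA.
Qed.

Lemma fpsD_sin e : fpsD (fps_sin e) = fps_cos e.
Proof.
apply: fpsP => n; rewrite /fpsD /fps_cos /fps_sin /= uphalf_half.
case: (odd n); first by rewrite !mulr0.
by rewrite -(fact_invS n) add0n mulrCA.
Qed.

Lemma fps_cos0E e : fps_cos e 0%N = 1.
Proof. by rewrite /fps_cos /= expr0 fact0 divr1. Qed.

Lemma fps_sin0E e : fps_sin e 0%N = 0.
Proof. by []. Qed.

Lemma fpsX_sinhc : fpsX * fps_sinhc = fps_sin 1.
Proof.
apply: fpsP => -[|n]; rewrite ?fpsXM0E // fpsXMSE /fps_sinhc /fps_sin /=.
by case: (odd n); rewrite // expr1n mul1r.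
Qed.

Lemma fps_sinhc0E : fps_sinhc 0%N = 1.
Proof. by rewrite /fps_sinhc /= invr1. Qed.

Lemma fps_const f : fpsD f = 0 -> f = fpsC (f 0%N) :> fps K.
Proof.
move=> Df; apply: fpsP => -[|n] //; have := congr1 (fun g : fps K => g n) Df.
by move=> /eqP; rewrite mulf_eq0 pnatr_eq0 /= => /eqP.
Qed.

Lemma fps_cos2B e :
  fps_cos e * fps_cos e - fpsC e * (fps_sin e * fps_sin e) = 1.
Proof.
rewrite -[RHS](fpsC1 (K := K)) [LHS]fps_const.
  by rewrite fpsDE fpsNE fpsCME !fpsM0E fps_cos0E fps_sin0E !mulr0 subr0 mulr1.
rewrite fpsDD fpsDN !fpsDM fpsDC fpsD_cos fpsD_sin; ring.
Qed.

(** A first-order linear system with vanishing initial values has only the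
    zero solution. *)
Lemma fps_ode2_eq0 c e (u v : fps K) :
  fpsD u = fpsC c * v -> fpsD v = fpsC e * u -> u 0%N = 0 -> v 0%N = 0 ->
  u = 0 /\ v = 0.
Proof.
move=> Du Dv u0 v0.
suff uv n : u n = 0 /\ v n = 0 by split; apply: fpsP => n; case: (uv n).
elim: n => [|n [un vn]] //.
have := congr1 (fun f : fps K => f n) Du.
have := congr1 (fun f : fps K => f n) Dv.
rewrite !fpsCME un vn !mulr0.
by move=> /eqP + /eqP; rewrite !mulf_eq0 !pnatr_eq0 /= => /eqP -> /eqP ->.
Qed.

Lemma fps_scale2_cosh_sinh :
  fps_scale 2 (fps_cos 1) = fps_cos 1 * fps_cos 1 + fps_sin 1 * fps_sin 1 /\
  fps_scale 2 (fps_sin 1) = fpsC 2 * (fps_sin 1 * fps_cos 1).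
Proof.
pose u := fps_scale 2 (fps_cos 1)
  - (fps_cos 1 * fps_cos 1 + fps_sin 1 * fps_sin 1).
pose v := fps_scale 2 (fps_sin 1) - fpsC 2 * (fps_sin 1 * fps_cos 1).
have [] := @fps_ode2_eq0 2 2 u v.
- rewrite /u fpsDD fpsDN !fpsDD !fpsDM fpsDscale fpsD_cos fpsD_sin fpsC1.
  by rewrite /v mul1r fpsC2; ring.
- rewrite /v fpsDD fpsDN !fpsDM fpsDscale fpsDC fpsD_cos fpsD_sin fpsC1.
  by rewrite /u mul1r fpsC2; ring.
- rewrite /u !fpsDE fpsNE fpsDE !fpsM0E /fps_scale fps_cos0E fps_sin0E.
  by rewrite expr0 !mul1r mulr0 addr0 subrr.
- rewrite /v !fpsDE fpsNE fpsCME !fpsM0E /fps_scale fps_cos0E fps_sin0E.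
  by rewrite expr0 !mul1r mul0r mulr0 subrr.
by move=> /subr0_eq -> /subr0_eq ->.
Qed.

(** * Tangent and hyperbolic tangent *)

(** The recurrence for the Taylor coefficients of the tangent, [t k] being
    the coefficient of degree [2 k + 1]; it says that [tan' = 1 + tan^2]. *)
Definition tan_recurrence t :=
  t 0%N = 1 /\
  forall k, (2 * k + 3)%:R * t k.+1 = \sum_(i < k.+1) t i * t (k - i)%N.

(** The tangent series for [e = -1], the hyperbolic tangent for [e = 1]. *)
Definition fps_tan e t : fps K :=
  fun n => if odd n then (- e) ^+ n./2 * t n./2 else 0.

Lemma fps_tan_odd e t : fps_odd (fps_tan e t).
Proof. by move=> n; rewrite /fps_tan => /negPf ->. Qed.

Lemma fps_tanE e t k : fps_tan e t (2 * k).+1 = (- e) ^+ k * t k.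
Proof. by rewrite /fps_tan /= mul2n odd_double /= uphalf_double. Qed.

Lemma fpsD_tan e t : tan_recurrence t ->
  fpsD (fps_tan e t) = 1 - fpsC e * (fps_tan e t * fps_tan e t).
Proof.
move=> [t0 tS]; apply: fpsP => n; rewrite fpsDE fpsNE fpsCME.
have [on|en] := boolP (odd n).
  case: n on => // n /= on.
  rewrite fps_oddME; last exact: fps_tan_odd.
  rewrite big1_seq; last first.
    move=> k; rewrite mem_index_iota /= ltnS => lek.
    rewrite [X in _ * X]fps_tan_odd ?mulr0 //.
    rewrite oddB ?(negPf on) ?mul2n ?odd_double //.
    rewrite -leq_double in lek; apply: leq_trans lek _.
    by rewrite -[leqRHS](odd_double_half n) leq_addl.
  rewrite mulr0 subr0 fps1E /= /fpsD fps_tan_odd ?mulr0 //= negbK.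
  by rewrite on.
have -> : n = (2 * n./2)%N by rewrite mul2n even_halfK.
case: (n./2) => [|k].
  by rewrite /fpsD muln0 fpsM0E /fps_tan /= t0 mulr0 mulr0 subr0 expr0 !mulr1.
rewrite /fpsD fps_tanE mulnS add2n fps_oddME; last exact: fps_tan_odd.
rewrite fps1E /= sub0r mulrCA.
have -> : (2 * k).+3 = (2 * k + 3)%N by rewrite addn3.
rewrite tS exprS mulNr mulNr -mulrA; congr (- (_ * _)).
rewrite uphalf_half mul2n odd_double doubleK add0n big_mkord mulr_sumr.
apply: eq_bigr => i _; rewrite -!mul2n !fps_tanE.
have ik : (i <= k)%N by rewrite -ltnS.
rewrite (_ : ((2 * k).+1 - 2 * i)%N = (2 * (k - i)).+1); last first.
  by rewrite subSn ?mulnBr // leq_mul2l.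
by rewrite fps_tanE -{1}(subnKC ik) exprD mulrACA.
Qed.

Lemma fps_tan_cos e t : tan_recurrence t ->
  fps_tan e t * fps_cos e = fps_sin e.
Proof.
move=> tr; apply/subr0_eq.
apply: (@fps_ode_eq0 _ (- (fpsC e * fps_tan e t))).
  by rewrite fpsDD fpsDN fpsDM (fpsD_tan e tr) fpsD_cos fpsD_sin; ring.
by rewrite fpsDE fpsNE fpsM0E fps_sin0E fps_tan_odd // mul0r subr0.
Qed.

(** The equation behind the recurrence for the polynomials [p]: with
    [F = exp (x t) cos (a t)],
    [x^2 F = F'' + 2 a (tan (a t) F)' - a^2 F]. *)
Lemma fps_exp_cos_eq x a t : tan_recurrence t ->
  let F := fps_exp x * fps_scale a (fps_cos (-1)) in
  fpsC (x ^+ 2) * F = fpsD (fpsD F)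
    + fpsC (2 * a) * fpsD (fps_scale a (fps_tan (-1) t) * F)
    - fpsC (a ^+ 2) * F.
Proof.
move=> tr F.
have -> : fps_scale a (fps_tan (-1) t) * F =
          fps_exp x * fps_scale a (fps_sin (-1)).
  by rewrite /F mulrCA -fps_scaleM (fps_tan_cos _ tr).
have DS : fpsD (fps_scale a (fps_sin (-1))) =
          fpsC a * fps_scale a (fps_cos (-1)) by rewrite fpsDscale fpsD_sin.
have DC : fpsD (fps_scale a (fps_cos (-1))) =
          - (fpsC a * fps_scale a (fps_sin (-1))).
  by rewrite fpsDscale fpsD_cos fps_scaleM fps_scaleC fpsCN1; ring.
rewrite /F !(fpsDM, fpsDD, fpsDN, DS, DC, fpsD_exp, fpsDC).
by rewrite !expr2 !fpsCM fpsC2; ring.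
Qed.

End FormalTrigonometry.

(** * Hyperbolic cotangent and cosecant *)

Section FormalCotangent.
Variables (K : numFieldType) (t : nat -> K) (L : fps K).
Hypothesis t_tan : tan_recurrence t.
Hypothesis L0 : L 0%N = 1.
Hypothesis L_dup : fps_scale 2 L = L + fpsX * fps_tan 1 t.

Local Notation C := (fps_cos 1 : fps K).
Local Notation S := (fps_sin 1 : fps K).
Local Notation Q := (fps_sinhc K).

Lemma fps_scale2_inj : injective (fps_scale (2 : K)).
Proof.
move=> f g fg; apply: fpsP => n; have := congr1 (fun h : fps K => h n) fg.
by move/mulfI; apply; rewrite expf_neq0 // pnatr_eq0.
Qed.

Lemma fps_scale2_sinhc : fps_scale 2 Q = Q * C.
Proof.
have [_ S2] := fps_scale2_cosh_sinh K.
apply: fpsX_inj; apply: (@fps_regular _ (fpsC 2)); first by rewrite pnatr_eq0.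
transitivity (fps_scale 2 (fpsX * Q)).
  by rewrite fps_scaleM fps_scaleX; ring.
by rewrite fpsX_sinhc S2 -fpsX_sinhc; ring.
Qed.

(** The duplication formula [2 t coth (2 t) = t coth t + t tanh t] and the
    value at zero characterize the series [L] as [t coth t]. *)
Lemma fps_coth_sinhc : L * Q = C.
Proof.
have [C2 _] := fps_scale2_cosh_sinh K.
apply/subr0_eq; set W := L * Q - C.
have W2 : fps_scale 2 W = W * C.
  rewrite /W fps_scaleD fps_scaleN fps_scaleM L_dup fps_scale2_sinhc C2.
  have Th : fps_tan 1 t * C = S := fps_tan_cos 1 t_tan.
  have -> : (L + fpsX * fps_tan 1 t) * (Q * C) =
            L * Q * C + (fpsX * Q) * (fps_tan 1 t * C) by ring.
  by rewrite Th fpsX_sinhc; ring.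
have W0 : W 0%N = 0.
  by rewrite /W fpsDE fpsNE fpsM0E L0 fps_sinhc0E fps_cos0E mulr1 subrr.
apply: fpsP => n; elim/ltn_ind: n => -[_|n IHn] //.
have := congr1 (fun f : fps K => f n.+1) W2; rewrite fpsME big_ord_recr /= big1.
  rewrite add0r subnn fps_cos0E mulr1 /fps_scale => /eqP.
  rewrite -subr_eq0 -[X in _ - X]mul1r -mulrBl mulf_eq0 subr_eq0 -natrX.
  by rewrite pnatr_eq1 -[1%N]/(2 ^ 0)%N eqn_exp2l //= => /eqP.
by move=> i _; rewrite IHn // mul0r.
Qed.

(** The series [t / sinh t = t coth (t / 2) - t coth t]. *)
Definition fps_csch : fps K := fpsC 2 * fps_scale 2^-1 L - L.

Lemma fps_csch_sinhc : fps_csch * Q = 1.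
Proof.
have [C2 _] := fps_scale2_cosh_sinh K.
have Q2 := fps_scale2_sinhc; have LQ := fps_coth_sinhc.
have scale2V : fps_scale 2 (fps_scale 2^-1 L) = L.
  rewrite fps_scaleA mulfV ?pnatr_eq0 //.
  by apply: fpsP => n; rewrite /fps_scale expr1n mul1r.
apply: fps_scale2_inj; rewrite fps_scale1 fps_scaleM fps_scaleD fps_scaleN.
rewrite fps_scaleM scale2V fps_scaleC.
have -> : (fpsC 2 * L - fps_scale 2 L) * fps_scale 2 Q =
          fpsC 2 * (L * fps_scale 2 Q) - fps_scale 2 (L * Q).
  by rewrite fps_scaleM; ring.
rewrite LQ Q2 C2.
have -> : fpsC 2 * (L * (Q * C)) = fpsC 2 * (L * Q) * C by ring.
by rewrite LQ fpsC2 -[RHS](fps_cos2B (1 : K)) fpsC1; ring.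
Qed.

Lemma fpsXD_sinhc : fpsX * fpsD Q = C - Q.
Proof.
have := congr1 (@fpsD K) (fpsX_sinhc K); rewrite fpsDM fpsDX fpsD_sin => <-.
by ring.
Qed.

Lemma fps_sinhc_reg f g : Q * Q * f = Q * Q * g -> f = g :> fps K.
Proof.
by apply: fps_regular; rewrite fpsM0E fps_sinhc0E mulr1 oner_eq0.
Qed.

(** [t^2 / sinh^2 t = - t^2 (coth t)'] *)
Lemma fps_csch2 : fps_csch * fps_csch = L - fpsX * fpsD L.
Proof.
have KQ := fps_csch_sinhc; have LQ := fps_coth_sinhc; have XQ := fpsX_sinhc K.
have XD := fpsXD_sinhc.
have DLQ : fpsD L * Q = S - L * fpsD Q.
  have := congr1 (@fpsD K) LQ; rewrite fpsDM fpsD_cos fpsC1 mul1r => <-.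
  by ring.
apply: fps_sinhc_reg.
have -> : Q * Q * (fps_csch * fps_csch) = (fps_csch * Q) * (fps_csch * Q).
  by ring.
have -> : Q * Q * (L - fpsX * fpsD L) =
          (L * Q) * Q - (fpsX * Q) * (fpsD L * Q) by ring.
rewrite KQ DLQ mulrBr.
have -> : fpsX * Q * (L * fpsD Q) = (L * Q) * (fpsX * fpsD Q) by ring.
rewrite XD LQ XQ mulr1 -(fps_cos2B (1 : K)) fpsC1; ring.
Qed.

(** [t^2 cosh t / sinh^2 t = - t^2 (1 / sinh t)'] *)
Lemma fps_csch2_cosh :
  fps_csch * fps_csch * C = fps_csch - fpsX * fpsD fps_csch.
Proof.
have KQ := fps_csch_sinhc; have XD := fpsXD_sinhc.
have DKQ : fpsD fps_csch * Q = - (fps_csch * fpsD Q).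
  have := congr1 (@fpsD K) KQ; rewrite fpsDM fpsD1 => /eqP.
  by rewrite addr_eq0 => /eqP.
apply: fps_sinhc_reg.
have -> : Q * Q * (fps_csch * fps_csch * C) =
          (fps_csch * Q) * (fps_csch * Q) * C by ring.
have -> : Q * Q * (fps_csch - fpsX * fpsD fps_csch) =
          (fps_csch * Q) * Q - (fpsX * Q) * (fpsD fps_csch * Q) by ring.
rewrite DKQ.
have -> : fpsX * Q * - (fps_csch * fpsD Q) =
          - ((fps_csch * Q) * (fpsX * fpsD Q)) by ring.
by rewrite KQ XD; ring.
Qed.

(** With [c = cosh x], [s = sinh x] and [u] the Taylor series at [x] of the
    hyperbolic secant, this is the identity
    [(sech^2 x + 1 / sinh^2 t) sech (x + t)
      = sech x cosh t / sinh^2 t + sech' x / sinh t]. *)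
Lemma fps_sech_eq (c s : K) (u : fps K) : c != 0 -> c ^+ 2 - s ^+ 2 = 1 ->
  u * (fpsC c * C + fpsC s * S) = 1 ->
  fpsC (c^-1 ^+ 2) * (fpsX * (fpsX * u)) =
    - ((L - fpsX * fpsD L) * u)
    + fpsC c^-1 * (fps_csch - fpsX * fpsD fps_csch)
    - fpsC (s / c ^+ 2) * (fpsX * fps_csch).
Proof.
move=> c0 cs uCS; have KQ := fps_csch_sinhc; have XQ := fpsX_sinhc K.
rewrite -fps_csch2 -fps_csch2_cosh.
have cV : fpsC c * fpsC c^-1 = 1 by rewrite -fpsCM mulfV // fpsC1.
have csF : fpsC c * fpsC c - fpsC s * fpsC s = 1.
  by rewrite -!fpsCM -fpsCB -!expr2 cs fpsC1.
have CS : C * C - S * S = 1.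
  by rewrite -[RHS](fps_cos2B (1 : K)) fpsC1 mul1r.
(* Both sides are multiplied by [sinh^2 t / t^2 * cosh^2 x * cosh (x + t)]. *)
apply: (@fps_regular _ (Q * Q * (fpsC (c ^+ 2) * (fpsC c * C + fpsC s * S)))).
  rewrite !fpsM0E fps_sinhc0E fpsDE !fpsCME fps_cos0E fps_sin0E mulr0 addr0.
  by rewrite !mulr1 mul1r mulf_neq0 // expf_neq0.
set E := fpsC c * C + fpsC s * S in uCS *.
rewrite !expr2 !fpsCM invfM mulrA !fpsCM.
set c1 := fpsC c in csF cV E uCS *; set s1 := fpsC s in csF E uCS *.
set d1 := fpsC c^-1 in cV *.
transitivity ((c1 * d1) * (c1 * d1) * ((fpsX * Q) * (fpsX * Q)) * (u * E)).
  by ring.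
rewrite cV XQ uCS !mulr1.
transitivity (- ((fps_csch * Q) * (fps_csch * Q) * c1 * c1 * (u * E))
   + (c1 * d1) * c1 * E * ((fps_csch * Q) * (fps_csch * Q)) * C
   - (c1 * d1) * (c1 * d1) * s1 * E * (fpsX * Q) * (fps_csch * Q));
  last by ring.
rewrite KQ uCS cV XQ !mul1r !mulr1 /E.
have -> : S * S = (c1 * c1 - s1 * s1) * (S * S) by rewrite csF mul1r.
have -> : - (c1 * c1) = - (c1 * c1 * (C * C - S * S)) by rewrite CS mulr1.
by ring.
Qed.

End FormalCotangent.

(** * Finite sums of inverse even powers *)

Section InversePowerSums.
Variable K : realFieldType.

(** The sums of [1 / n], of [1 / n^(2 k)], and of [1 / w^(2 k)] for odd [w],
    over the first positive integers or odd numbers. *)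
Definition harmonic_sum n : K := \sum_(0 <= i < n) i.+1%:R^-1.

Definition zeta_sum k N : K := \sum_(0 <= a < N) (a.+1%:R ^+ (2 * k))^-1.

Definition odd_zeta_sum k N : K :=
  \sum_(0 <= a < N) ((2 * a).+1%:R ^+ (2 * k))^-1.

Lemma zeta_sum_double k N :
  zeta_sum k (2 * N) = odd_zeta_sum k N + (4 ^+ k)^-1 * zeta_sum k N.
Proof.
rewrite /zeta_sum /odd_zeta_sum mulr_sumr.
elim: N => [|N IHN]; first by rewrite muln0 !big_nil addr0.
rewrite mulnS add2n big_nat_recr //= big_nat_recr //= IHN.
rewrite [X in _ = X + _]big_nat_recr //= [X in _ = _ + X]big_nat_recr //=.
have -> : ((2 * N).+2%:R ^+ (2 * k))^-1 =
          (4 ^+ k)^-1 * (N.+1%:R ^+ (2 * k))^-1 :> K.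
  have -> : ((2 * N).+2 = 2 * N.+1)%N by rewrite mulnS.
  by rewrite -invfM natrM exprMn [2%:R ^+ _]exprM -natrX.
by ring.
Qed.

(** Comparison with a telescoping sum. *)
Lemma zeta_sum_le k N : (0 < k)%N -> zeta_sum k N <= 2.
Proof.
move=> k0.
have le1 n : (n.+1%:R ^+ (2 * k))^-1 <= (n.+1%:R ^+ 2)^-1 :> K.
  rewrite lef_pV2 ?posrE ?exprn_gt0 ?ltr0n //.
  by apply: ler_weXn2l; rewrite ?ler1n // leq_pmulr.
case: N => [|N]; first by rewrite /zeta_sum big_nil.
suff : zeta_sum k N.+1 <= 2 - N.+1%:R^-1.
  by move=> /le_trans; apply; rewrite gerBl invr_ge0 ler0n.
rewrite /zeta_sum; elim: N => [|N IHN].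
  by rewrite big_nat1 (le_trans (le1 _)) // expr1n invr1; lra.
rewrite big_nat_recr //= (le_trans (lerD IHN (le1 _))) //.
have N0 : 0 <= N%:R :> K by rewrite ler0n.
have -> : N.+2%:R = N%:R + 2 :> K by rewrite -natrD addn2.
have -> : N.+1%:R = N%:R + 1 :> K by rewrite natr1.
rewrite -subr_ge0.
have -> : (2 - (N%:R + 2)^-1) - (2 - (N%:R + 1)^-1 + ((N%:R + 2) ^+ 2)^-1) =
   ((N%:R + 1) * (N%:R + 2) ^+ 2)^-1 :> K.
  by field; rewrite !lt0r_neq0 //; lra.
by rewrite invr_ge0 mulr_ge0 ?exprn_ge0 //; lra.
Qed.

Lemma odd_zeta_sum_le k N : (0 < k)%N -> odd_zeta_sum k N <= 2.
Proof.
move=> k0; apply: le_trans (zeta_sum_le (2 * N) k0).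
rewrite zeta_sum_double lerDl mulr_ge0 // ?invr_ge0 ?exprn_ge0 //.
by apply: sumr_ge0 => a _; rewrite invr_ge0 exprn_ge0 // ler0n.
Qed.

Lemma harmonic_sumS n : harmonic_sum n.+1 = harmonic_sum n + n.+1%:R^-1.
Proof. by rewrite /harmonic_sum big_nat_recr. Qed.

(** The term [b = a] of the sum is zero, being the inverse of zero. *)
Lemma sum_inv_diff_succ a :
  \sum_(0 <= b < a.+1) (b%:R - a%:R)^-1 = - harmonic_sum a.
Proof.
elim: a => [|a IHa].
  by rewrite big_nat1 subrr invr0 /harmonic_sum big_nil oppr0.
rewrite big_nat_recl //= harmonic_sumS opprD -IHa sub0r invrN.
rewrite addrC; congr (_ + _); apply: eq_bigr => b _.
by congr (_^-1); rewrite -[b.+1%:R]natr1 -[a.+1%:R]natr1; ring.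
Qed.

Lemma sum_inv_diff a M :
  \sum_(0 <= b < a.+1 + M) (b%:R - a%:R)^-1 = harmonic_sum M - harmonic_sum a.
Proof.
elim: M => [|M IHM].
  by rewrite addn0 sum_inv_diff_succ /harmonic_sum big_nil sub0r.
rewrite addnS big_nat_recr //= IHM harmonic_sumS.
by rewrite addSnnS natrD [a%:R + _]addrC addrK addrAC.
Qed.

Lemma sum_inv_add a N :
  \sum_(0 <= b < N) (a + b).+1%:R^-1 = harmonic_sum (a + N) - harmonic_sum a.
Proof.
elim: N => [|N IHN]; first by rewrite big_nil addn0 subrr.
by rewrite big_nat_recr //= IHN addnS harmonic_sumS addrAC.
Qed.

(** Sum of [1 / (w_b^2 - w_a^2)] over the odd numbers [w_b = 2 b + 1] with
    [b < N]; the term [b = a] is again zero. *)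
Lemma sum_inv_odd_sqrB a N : (a < N)%N ->
  \sum_(0 <= b < N) ((2 * b).+1%:R ^+ 2 - (2 * a).+1%:R ^+ 2)^-1 =
  (4 * (2 * a).+1%:R)^-1 *
  ((2 * a).+1%:R^-1 - (harmonic_sum (N + a) - harmonic_sum (N - a.+1))).
Proof.
move=> aN.
have -> : \sum_(0 <= b < N) ((2 * b).+1%:R ^+ 2 - (2 * a).+1%:R ^+ 2)^-1 =
  \sum_(0 <= b < N) (4 * (2 * a).+1%:R)^-1 *
   ((b%:R - a%:R)^-1 - (a + b).+1%:R^-1
     + (if b == a then (2 * a).+1%:R^-1 else 0)) :> K.
  apply: eq_bigr => b _; have [->|nab] := eqVneq b a.
    by rewrite !subrr !invr0 addnn -mul2n sub0r addNr mulr0.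
  have ab0 : b%:R - a%:R != 0 :> K by rewrite subr_eq0 eqr_nat.
  have h0 : (a + b)%:R + 1 != 0 :> K by rewrite natr1 pnatr_eq0.
  have h1 : (2 * a)%:R + 1 != 0 :> K by rewrite natr1 pnatr_eq0.
  move: h0 h1; rewrite -!natr1 !natrM natrD addr0 => h0 h1.
  have -> : (2%:R * b%:R + 1) ^+ 2 - (2%:R * a%:R + 1) ^+ 2 =
            4 * ((b%:R - a%:R) * (a%:R + b%:R + 1)) :> K by ring.
  by field; rewrite h0 h1 ab0.
rewrite -mulr_sumr; congr (_ * _); rewrite !big_split /= sumrN sum_inv_add.
rewrite -{1}(subnKC aN) sum_inv_diff -big_mkcond /=.
rewrite big_nat1_eq /= aN.
by rewrite [(a + N)%N]addnC; ring.
Qed.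

(** Geometric sum of ratio [w^2 / v^2]. *)
Lemma geometric_sum_inv (v w : K) j : v != 0 -> w != 0 -> v ^+ 2 != w ^+ 2 ->
  \sum_(0 <= i < j.+1) (v ^+ (2 * i.+1))^-1 * (w ^+ (2 * (j - i).+1))^-1 =
  (v ^+ (2 * j.+1))^-1 / (w ^+ 2 - v ^+ 2)
  + (w ^+ (2 * j.+1))^-1 / (v ^+ 2 - w ^+ 2).
Proof.
move=> v0 w0 vw.
have vwB : v ^+ 2 - w ^+ 2 != 0 by rewrite subr_eq0.
have wvB : w ^+ 2 - v ^+ 2 != 0 by rewrite subr_eq0 eq_sym.
pose x := v^-1 ^+ 2; pose y := w^-1 ^+ 2.
have v2 : v ^+ 2 != 0 by rewrite expf_neq0.
have w2 : w ^+ 2 != 0 by rewrite expf_neq0.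
have -> : \sum_(0 <= i < j.+1) (v ^+ (2 * i.+1))^-1 * (w ^+ (2 * (j - i).+1))^-1
   = x * y * \sum_(i < j.+1) y ^+ (j.+1.-1 - i) * x ^+ i.
  rewrite big_mkord mulr_sumr; apply: eq_bigr => i _ /=.
  by rewrite -!exprVn !exprM -/x -/y !exprS; ring.
rewrite -!exprVn !exprM -/x -/y.
have yx : y - x != 0.
  rewrite subr_eq0; apply: contraNneq vw; rewrite /x /y !exprVn => /invr_inj ->.
  exact: eqxx.
apply: (mulfI yx); rewrite mulrCA -subrXX.
set X := x ^+ j.+1; set Y := y ^+ j.+1.
by rewrite /x /y; field; rewrite v0 w0 vwB wvB.
Qed.

(** The error term of the truncated convolution identity. *)
Definition odd_zeta_error j N : K :=
  2^-1 * \sum_(0 <= a < N) ((2 * a).+1%:R ^+ (2 * j).+3)^-1 *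
    (harmonic_sum (N + a) - harmonic_sum (N - a.+1)).

(** Truncated form of [odd_zeta_conv] below: the diagonal of the double sum
    and the terms [1 / (4 w^2)] of [sum_inv_odd_sqrB] give the main term, the
    harmonic sums give the error. *)
Lemma odd_zeta_sum_conv j N :
  \sum_(0 <= i < j.+1) odd_zeta_sum i.+1 N * odd_zeta_sum (j - i).+1 N =
  (j%:R + 3 / 2) * odd_zeta_sum j.+2 N - odd_zeta_error j N.
Proof.
pose w a : K := (2 * a).+1%:R.
have w0 a : w a != 0 by rewrite pnatr_eq0.
pose g a b := (w b ^+ 2 - w a ^+ 2)^-1.
pose x a := (w a ^+ (2 * j.+1))^-1.
have -> : \sum_(0 <= i < j.+1) odd_zeta_sum i.+1 N * odd_zeta_sum (j - i).+1 N
  = \sum_(0 <= a < N) \sum_(0 <= b < N) \sum_(0 <= i < j.+1)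
      (w a ^+ (2 * i.+1))^-1 * (w b ^+ (2 * (j - i).+1))^-1.
  under eq_bigr => i _ do rewrite /odd_zeta_sum big_distrlr /=.
  rewrite exchange_big; apply: eq_bigr => a _ /=.
  by rewrite exchange_big.
have E a b : \sum_(0 <= i < j.+1)
      (w a ^+ (2 * i.+1))^-1 * (w b ^+ (2 * (j - i).+1))^-1 =
    (if b == a then j.+1%:R * (w a ^+ (2 * j.+2))^-1 else 0)
    + x a * g a b + x b * g b a.
  have [->|nab] := eqVneq b a.
    rewrite /g subrr invr0 !mulr0 !addr0.
    rewrite (eq_big_nat _ _ (F2 := fun=> (w a ^+ (2 * j.+2))^-1)).
      by rewrite sumr_const_nat subn0 mulr_natl.
    move=> i /andP[_ ij]; rewrite -invfM -exprD -mulnDr addSn addnS subnKC //.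
  rewrite geometric_sum_inv // ?add0r //.
  rewrite eqrXn2 ?ler0n // eqr_nat eqSS eqn_pmul2l //.
  by rewrite eq_sym.
under eq_bigr => a _ do under eq_bigr => b _ do rewrite E.
have G : \sum_(0 <= a < N) \sum_(0 <= b < N) x a * g a b =
   4^-1 * odd_zeta_sum j.+2 N - 2^-1 * odd_zeta_error j N.
  rewrite /odd_zeta_error mulrA /odd_zeta_sum !mulr_sumr -sumrB.
  apply: eq_big_nat => a /andP[_ aN]; rewrite -mulr_sumr /g.
  rewrite sum_inv_odd_sqrB // /x -/(w a).
  have -> : (2 * j.+2 = (2 * j.+1).+2)%N by rewrite [LHS]mulnS.
  have -> : ((2 * j).+3 = (2 * j.+1).+1)%N by rewrite mulnS.
  rewrite -/(w a); move: (2 * j.+1)%N (w a) (w0 a) => n v v0.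
  have W0 : v ^+ n != 0 by rewrite expf_neq0.
  by rewrite !exprS; field; rewrite W0 v0.
have G' : \sum_(0 <= a < N) \sum_(0 <= b < N) x b * g b a =
   4^-1 * odd_zeta_sum j.+2 N - 2^-1 * odd_zeta_error j N.
  by rewrite exchange_big G.
under eq_bigr => a _ do rewrite !big_split /=.
rewrite !big_split /= G G'.
have -> : \sum_(0 <= a < N) \sum_(0 <= b < N)
   (if b == a then j.+1%:R * (w a ^+ (2 * j.+2))^-1 else 0) =
   j.+1%:R * odd_zeta_sum j.+2 N.
  rewrite /odd_zeta_sum mulr_sumr; apply: eq_big_nat => a /andP[_ aN].
  rewrite -big_mkcond /=.
  by rewrite big_nat1_eq /= aN.
by rewrite -natr1; field.
Qed.

Lemma harmonic_sumB n m :
  0 <= harmonic_sum (n + m) - harmonic_sum n <= m%:R / n.+1%:R.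
Proof.
elim: m => [|m /andP[ge le]]; first by rewrite addn0 subrr mul0r lexx.
rewrite addnS harmonic_sumS addrAC.
rewrite addr_ge0 ?invr_ge0 ?ler0n //= -[m.+1%:R]natr1 mulrDl mul1r lerD //.
by rewrite lef_pV2 ?posrE ?ltr0n // ler_nat ltnS leq_addr.
Qed.

(** From [1 / (w^2 (N - a)) = (2 / w^2 + 1 / (w (N - a))) / (2 N + 1)] for
    [w = 2 a + 1]. *)
Lemma odd_zeta_error_bound j N :
  0 <= odd_zeta_error j N <= 5 / N.+1%:R.
Proof.
have HB a : (a < N)%N ->
    0 <= harmonic_sum (N + a) - harmonic_sum (N - a.+1)
      <= (2 * a).+1%:R / (N - a)%:R.
  move=> aN; have := harmonic_sumB (N - a.+1) (2 * a).+1.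
  have -> : (N - a.+1 + (2 * a).+1 = N + a)%N.
    by rewrite mul2n -addnn -addSn addnA subnK.
  by rewrite subnSK.
have B a : (0 <= a < N)%N -> 0 <= (((2 * a).+1%:R : K) ^+ (2 * j).+3)^-1 *
    (harmonic_sum (N + a) - harmonic_sum (N - a.+1))
     <= N.+1%:R^-1 * (2 * ((2 * a).+1%:R ^+ (2 * 1))^-1 + N%:R^-1).
  move=> /andP[_ aN]; have /andP[ge le] := HB a aN.
  have W0 : 0 < (2 * a).+1%:R :> K by rewrite ltr0n.
  have V0 : 0 <= ((2 * a).+1%:R ^+ (2 * j).+3)^-1 :> K.
    by rewrite invr_ge0 exprn_ge0 // ltW.
  rewrite mulr_ge0 //=.
  have le1 : ((2 * a).+1%:R ^+ (2 * j).+3)^-1 <= ((2 * a).+1%:R ^+ 3)^-1 :> K.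
    rewrite lef_pV2 ?posrE ?exprn_gt0 //.
    by apply: ler_weXn2l; rewrite ?ler1n // -addn3 leq_addl.
  have -> : N%:R = a%:R + (N - a)%:R :> K by rewrite -natrD subnKC // ltnW.
  have -> : N.+1%:R = a%:R + (N - a)%:R + 1 :> K.
    by rewrite -natrD subnKC ?natr1 // ltnW.
  have M1 : 1 <= (N - a)%:R :> K by rewrite ler1n subn_gt0.
  have a0 : 0 <= a%:R :> K by rewrite ler0n.
  apply: le_trans (ler_pM V0 ge le1 le) _ => {V0 ge le1 le}.
  rewrite -[(2 * a).+1%:R]natr1 natrM in W0 *.
  move: (N - a)%:R M1 => M M1.
  have M0 : 0 < M by lra.
  set A := a%:R in a0 W0 *.
  have -> : ((2%:R * A + 1) ^+ 3)^-1 * ((2%:R * A + 1) / M) =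
     (2 * A + 2 * M + 1)^-1 *
     (2 * ((2 * A + 1) ^+ 2)^-1 + ((2 * A + 1) * M)^-1).
    by field; rewrite !lt0r_neq0 //; lra.
  apply: ler_pM.
  - by rewrite invr_ge0; lra.
  - by rewrite addr_ge0 ?mulr_ge0 ?invr_ge0 ?mulr_ge0 ?exprn_ge0 //; lra.
  - by rewrite lef_pV2 ?posrE; lra.
  rewrite muln1 lerD2l lef_pV2 ?posrE ?mulr_gt0 //; [nra | lra].
have ge : 0 <= odd_zeta_error j N.
  rewrite /odd_zeta_error mulr_ge0 ?invr_ge0 //.
  by rewrite big_seq sumr_ge0 // => a; rewrite mem_index_iota => /B/andP[].
rewrite ge /=; apply: (@le_trans _ _ (N.+1%:R^-1 *
  (2 * odd_zeta_sum 1 N + \sum_(0 <= a < N) N%:R^-1))).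
  rewrite -[leRHS]mul1r /odd_zeta_error; apply: ler_pM.
  - by rewrite invr_ge0.
  - by rewrite big_seq sumr_ge0 // => a; rewrite mem_index_iota => /B/andP[].
  - by lra.
  rewrite /odd_zeta_sum mulr_sumr -big_split mulr_sumr.
  by apply: ler_sum_nat => a /B/andP[].
rewrite mulrC ler_wpM2r ?invr_ge0 ?ler0n //.
have le1 : \sum_(0 <= a < N) N%:R^-1 <= 1 :> K.
  rewrite sumr_const_nat subn0; case: N {HB B ge} => [|N]; first exact: ler01.
  by rewrite -[N.+1%:R^-1 *+ _]mulr_natl mulfV ?pnatr_eq0.
by have := @odd_zeta_sum_le 1 N isT; lra.
Qed.

End InversePowerSums.

Arguments harmonic_sum {K} n.
Arguments zeta_sum {K} k N.
Arguments odd_zeta_sum {K} k N.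
Arguments odd_zeta_error {K} j N.

(** * Values of the zeta function at even integers *)

Section EvenZeta.
Variable R : realType.
Local Open Scope classical_set_scope.

Lemma cvg_zeta_sum k : (0 < k)%N ->
  @zeta_sum R k @ \oo --> (zeta (2 * k)%:R : R).
Proof.
move=> k0.
have -> : zeta (2 * k)%:R = limn (@zeta_sum R k).
  rewrite /zeta; congr (limn _); apply/funext => N.
  rewrite /zeta_sum /series /=.
  by apply: eq_bigr => a _; rewrite powRN powR_mulrn ?ler0n.
apply: nondecreasing_is_cvgn.
  apply/nondecreasing_seqP => N; rewrite /zeta_sum big_nat_recr //= lerDl.
  by rewrite invr_ge0 exprn_ge0 // ler0n.
by exists 2 => _ [N _ <-]; exact: zeta_sum_le.
Qed.

(** The sum of [1 / w^(2 k)] over all odd [w], for positive [k]. *)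
Definition odd_zeta k : R := (1 - (4 ^+ k)^-1) * zeta (2 * k)%:R.

Lemma cvg_odd_zeta_sum k : (0 < k)%N ->
  @odd_zeta_sum R k @ \oo --> odd_zeta k.
Proof.
move=> k0; have cz := cvg_zeta_sum k0.
have -> : @odd_zeta_sum R k =
    (fun N => zeta_sum k (2 * N) - (4 ^+ k)^-1 * zeta_sum k N).
  by apply/funext => N; rewrite zeta_sum_double addrK.
rewrite /odd_zeta mulrBl mul1r; apply: cvgB; last exact: cvgZl_tmp.
apply: (@cvg_comp _ _ _ (fun N => (2 * N)%N) (@zeta_sum R k) \oo \oo) => //.
exact: cvg_mulnl.
Qed.

(** Limit of [odd_zeta_sum_conv]. *)
Lemma odd_zeta_conv j :
  \sum_(0 <= i < j.+1) odd_zeta i.+1 * odd_zeta (j - i).+1 =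
  (j%:R + 3 / 2) * odd_zeta j.+2.
Proof.
have err0 : @odd_zeta_error R j @ \oo --> (0 : R).
  apply: (@squeeze_cvgr _ \oo _ _ (fun=> 0) (fun N => 5 / N.+1%:R)).
  - by near=> N; exact: odd_zeta_error_bound.
  - exact: cvg_cst.
  - rewrite -(mulr0 (5 : R)); apply: cvgZl_tmp; exact: cvg_harmonic.
pose u : nat -> R := fun N => \sum_(0 <= i < j.+1)
  odd_zeta_sum i.+1 N * odd_zeta_sum (j - i).+1 N.
have uE : u = (fun N =>
    (j%:R + 3 / 2) * odd_zeta_sum j.+2 N - odd_zeta_error j N).
  by apply/funext => N; exact: odd_zeta_sum_conv.
have l1 : u @ \oo --> \sum_(0 <= i < j.+1) odd_zeta i.+1 * odd_zeta (j - i).+1.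
  apply: cvg_big => [|i _]; first exact: add_continuous.
  by apply: cvgM; exact: cvg_odd_zeta_sum.
have l2 : u @ \oo --> (j%:R + 3 / 2) * odd_zeta j.+2 - 0.
  by rewrite uE; apply: cvgB => //; apply: cvgZl_tmp; exact: cvg_odd_zeta_sum.
by rewrite subr0 in l2; exact: (cvg_unique _ l1 l2).
Unshelve. all: by end_near.
Qed.

Lemma sin_le (x : R) : 0 < x -> sin x <= x.
Proof.
move=> x0; have [c _] := @MVT R sin cos 0 x x0 (fun c _ => is_derive_sin c)
    (continuous_subspaceT (@continuous_sin R)).
rewrite sin0 !subr0 => ->; rewrite -[leRHS]mul1r ler_wpM2r ?cos_le1 //.
exact: ltW.
Qed.

Lemma mul_cos_le_sin (x : R) : 0 < x < pi -> x * cos x <= sin x.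
Proof.
move=> /andP[x0 xpi]; pose f (y : R) := sin y - y * cos y.
have df (y : R) : is_derive y 1 f (y * sin y).
  apply: is_derive_eq; rewrite /GRing.scale /=; ring.
have cf : continuous f.
  move=> y; apply: differentiable_continuous; apply/derivable1_diffP.
  exact: (@ex_derive _ _ _ _ _ _ _ (df y)).
have [c] := @MVT R f (fun y => y * sin y) 0 x x0 (fun c _ => df c)
  (continuous_subspaceT cf).
rewrite in_itv /= => /andP[c0 cx]; rewrite /f sin0 !mul0r !subr0 => E.
rewrite -subr_ge0 E mulr_ge0 ?(ltW x0) // mulr_ge0 ?(ltW c0) //.
by apply: sin_ge0_pi; rewrite (ltW c0) (ltW (lt_trans cx xpi)).
Qed.

(** Hence [1 / x^2 <= 1 / sin^2 x <= 1 + 1 / x^2]. *)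
Lemma inv_sin2_bound (x : R) : 0 < x < pi / 2 ->
  (x ^+ 2)^-1 <= (sin x ^+ 2)^-1 <= 1 + (x ^+ 2)^-1.
Proof.
move=> /andP[x0 xpi].
have xpi2 : 0 < x < pi by rewrite x0 (lt_trans xpi) // gtr_pMr ?pi_gt0 //; lra.
have s0 : 0 < sin x by apply: sin_gt0_pi.
have c0 : 0 < cos x by apply: cos_gt0_pihalf; rewrite xpi; lra.
have sx := sin_le x0; have xc := mul_cos_le_sin xpi2.
apply/andP; split.
  by rewrite lef_pV2 ?posrE ?exprn_gt0 // ler_pXn2r ?nnegrE // ltW.
have -> : (sin x ^+ 2)^-1 = 1 + (cos x / sin x) ^+ 2.
  rewrite exprMn exprVn -[X in X + _](@mulfV _ (sin x ^+ 2)); last first.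
    by rewrite expf_neq0 ?lt0r_neq0.
  by rewrite -mulrDl addrC cos2Dsin2 mul1r.
rewrite lerD2l -exprVn ler_pXn2r ?nnegrE ?divr_ge0 ?invr_ge0 //; try exact: ltW.
by rewrite ler_pdivrMr // mulrC ler_pdivlMr // mulrC.
Qed.

(** Angle halving: [1 / sin^2 x] is a quarter of the sum of the values at
    [x / 2] and [pi / 2 - x / 2]. *)
Lemma inv_sin2_half (x : R) : 0 < x < pi / 2 ->
  (sin (x / 2) ^+ 2)^-1 + (sin (pi / 2 - x / 2) ^+ 2)^-1 =
  4 * (sin x ^+ 2)^-1.
Proof.
move=> /andP[x0 xpi].
have s0 : 0 < sin (x / 2) by apply: sin_gt0_pihalf; lra.
have c0 : 0 < cos (x / 2) by apply: cos_gt0_pihalf; lra.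
have -> : sin (pi / 2 - x / 2) = cos (x / 2).
  by rewrite sinB sin_pihalf cos_pihalf mul0r subr0 mul1r.
have -> : sin x = 2 * (cos (x / 2) * sin (x / 2)).
  by rewrite mulr_natl -sin_mulr2n -mulr_natr; congr sin; field.
have := cos2Dsin2 (x / 2).
set s := sin (x / 2) in s0 *; set c := cos (x / 2) in c0 *.
move=> cs; transitivity ((c ^+ 2 + s ^+ 2) / (c ^+ 2 * s ^+ 2)).
  by field; rewrite !lt0r_neq0.
by rewrite cs; field; rewrite !lt0r_neq0.
Qed.

Lemma odd_angle_bound n a : (a < 2 ^ n)%N ->
  0 < (2 * a).+1%:R * (pi : R) / (2 ^ n.+2)%:R < pi / 2.
Proof.
move=> aN; have N0 : 0 < (2 ^ n)%:R :> R by rewrite ltr0n expn_gt0.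
have aN' : a%:R + 1 <= (2 ^ n)%:R :> R by rewrite natr1 ler_nat.
have -> : (2 ^ n.+2)%:R = 4 * (2 ^ n)%:R :> R by rewrite !expnS mulnA natrM.
apply/andP; split; first by rewrite divr_gt0 ?mulr_gt0 ?pi_gt0.
rewrite -natr1 natrM ltr_pdivrMr ?mulr_gt0 //.
suff : 0 < pi * (2 * (2 ^ n)%:R - (2 * a%:R + 1)) :> R by lra.
by rewrite mulr_gt0 ?pi_gt0 //; lra.
Qed.

(** The angles are the odd multiples of [pi / 2^(n + 2)] below [pi / 2]. *)
Lemma sum_inv_sin2 n :
  \sum_(0 <= a < 2 ^ n)
     (sin ((2 * a).+1%:R * pi / (2 ^ n.+2)%:R) ^+ 2)^-1 = 2 * 4 ^+ n :> R.
Proof.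
elim: n => [|n IHn].
  rewrite big_nat1 muln0 mul1r expr0 mulr1.
  have sp : (sin (pi / 4 : R)) ^+ 2 = 2^-1.
    have := cos_mulr2n (pi / 4 : R).
    have -> : (pi / 4) *+ 2 = pi / 2 :> R by rewrite -mulr_natr; field.
    rewrite cos_pihalf; have := cos2Dsin2 (pi / 4 : R).
    by rewrite -mulr_natr; lra.
  by rewrite -[(2 ^ 2)%N]/4%N sp invrK.
(* The indices [a] and [2 ^ n.+1 - 1 - a] come from the same angle. *)
rewrite expnS mul2n -addnn (@big_cat_nat _ _ _ (2 ^ n)) ?leq_addr //=.
rewrite -{2}[(2 ^ n)%N]add0n big_addn addnK.
rewrite [X in _ + X]big_nat_rev /= -big_split /= exprS mulrCA -IHn mulr_sumr.
apply: eq_big_nat => a /andP[_ aN]; rewrite -inv_sin2_half ?odd_angle_bound //.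
have N0 : (2 ^ n)%:R != 0 :> R by rewrite pnatr_eq0 expn_eq0.
have E : (2 ^ n.+2)%:R = 4 * (2 ^ n)%:R :> R.
  by rewrite !expnS mulnA natrM.
have E' : (2 ^ n.+3)%:R = 8 * (2 ^ n)%:R :> R.
  by rewrite !expnS !mulnA natrM.
congr (_^-1 + _^-1); congr (sin _ ^+ 2); rewrite E' E; first by field.
rewrite add0n -!natr1 !natrM natrD natrB // -natr1.
by field.
Qed.

(** The bounds on [1 / sin^2] turn [sum_inv_sin2] into a squeeze for the sums
    over the first [2^n] odd numbers. *)
Lemma odd_zeta1 : odd_zeta 1 = pi ^+ 2 / 8.
Proof.
have p0 := pi_gt0 R; have pn0 := lt0r_neq0 p0.
have c1 := cvg_odd_zeta_sum (ltnSn 0).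
have cs : (fun n => odd_zeta_sum 1 (2 ^ n) : R) @ \oo --> odd_zeta 1.
  apply: (@cvg_comp _ _ _ (expn 2) (@odd_zeta_sum R 1) \oo \oo) => //.
  apply/cvgnyPge => A; exists A => // n /= An.
  by rewrite (leq_trans An) // ltnW // ltn_expl.
suff cl : (fun n => odd_zeta_sum 1 (2 ^ n) : R) @ \oo --> pi ^+ 2 / 8.
  exact: (cvg_unique _ cs cl).
apply: (@squeeze_cvgr _ \oo _ _
   (fun n => pi ^+ 2 / 8 - pi ^+ 2 / 16 * 2^-1 ^+ n) (fun=> pi ^+ 2 / 8)).
- near=> n.
  have N0 : 0 < (2 ^ n)%:R :> R by rewrite ltr0n expn_gt0.
  pose x a : R := (2 * a).+1%:R * pi / (2 ^ n.+2)%:R.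
  have B a : (0 <= a < 2 ^ n)%N ->
     (x a ^+ 2)^-1 <= (sin (x a) ^+ 2)^-1 <= 1 + (x a ^+ 2)^-1.
    by move=> /andP[_ aN]; apply: inv_sin2_bound; exact: odd_angle_bound.
  have S : \sum_(0 <= a < 2 ^ n) (x a ^+ 2)^-1 =
      16 * 4 ^+ n / pi ^+ 2 * odd_zeta_sum 1 (2 ^ n).
    rewrite /odd_zeta_sum mulr_sumr; apply: eq_bigr => a _.
    have E4 : 4 ^+ n = (2 ^ n)%:R ^+ 2 :> R.
      by rewrite -!natrX -expnM mulnC expnM.
    have E : (2 ^ n.+2)%:R = 4 * (2 ^ n)%:R :> R.
      by rewrite !expnS mulnA natrM.
    have w0 : (2 * a).+1%:R != 0 :> R by rewrite pnatr_eq0.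
    rewrite /x E E4 muln1; move: _%:R w0 => w w0.
    move: (2 ^ n)%:R (lt0r_neq0 N0) pi pn0 => M M0 P P0.
    by field; rewrite w0 P0 M0.
  have le : \sum_(0 <= a < 2 ^ n) (x a ^+ 2)^-1 <= 2 * 4 ^+ n.
    by rewrite -sum_inv_sin2; apply: ler_sum_nat => a /B/andP[].
  have ge : 2 * 4 ^+ n <= (2 ^ n)%:R + \sum_(0 <= a < 2 ^ n) (x a ^+ 2)^-1.
    rewrite -sum_inv_sin2.
    have -> : (2 ^ n)%:R = \sum_(0 <= a < 2 ^ n) (1 : R).
      by rewrite sumr_const_nat subn0.
    by rewrite -big_split; apply: ler_sum_nat => a /B/andP[].
  rewrite S in le ge.
  have M0 : 0 < 16 * 4 ^+ n / pi ^+ 2 :> R.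
    by rewrite divr_gt0 ?mulr_gt0 ?exprn_gt0.
  rewrite -(ler_pM2l M0) -[X in _ && X](ler_pM2l M0).
  have E2 : (2 ^ n)%:R = 4 ^+ n * 2^-1 ^+ n :> R.
    by rewrite -exprMn natrX; congr (_ ^+ n); field.
  rewrite E2 in ge.
  have -> : 16 * 4 ^+ n / pi ^+ 2 * (pi ^+ 2 / 8) = 2 * 4 ^+ n :> R.
    by move: pi pn0 => P P0; field.
  have -> : 16 * 4 ^+ n / pi ^+ 2 *
     (pi ^+ 2 / 8 - pi ^+ 2 / 16 * 2^-1 ^+ n) =
     2 * 4 ^+ n - 4 ^+ n * 2^-1 ^+ n :> R.
    by move: pi pn0 => P P0; field.
  by rewrite le andbT; lra.
- rewrite -[X in _ --> X]subr0 -(mulr0 (pi ^+ 2 / 16)).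
  apply: cvgB; first exact: cvg_cst.
  by apply: cvgZl_tmp; apply: cvg_expr; rewrite ger0_norm; lra.
- exact: cvg_cst.
Unshelve. all: by end_near.
Qed.

(** The Taylor coefficients of the tangent, in terms of sums over the odd
    numbers. *)
Definition tan_coef k : R := 2 * (2 / pi) ^+ (2 * k.+1) * odd_zeta k.+1.

Lemma tan_coef_recurrence : tan_recurrence tan_coef.
Proof.
have p0 : pi != 0 :> R by rewrite lt0r_neq0 ?pi_gt0.
split; first by rewrite /tan_coef odd_zeta1 muln1; move: pi p0 => P P0; field.
move=> k; transitivity (4 * (2 / pi) ^+ (2 * k.+2) *
   \sum_(0 <= i < k.+1) odd_zeta i.+1 * odd_zeta (k - i).+1).
  by rewrite odd_zeta_conv /tan_coef natrD natrM; move: (_ ^+ _) => P; field.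
rewrite big_mkord mulr_sumr; apply: eq_bigr => i _; rewrite /tan_coef.
have -> : (2 * k.+2 = 2 * i.+1 + 2 * (k - i).+1)%N.
  by rewrite -mulnDr addSn addnS subnKC // -ltnS.
by rewrite exprD; ring.
Qed.

End EvenZeta.

(** * Coefficients of the hyperbolic cotangent *)

Section EvenZetaSeries.
Variable R : realType.

(** The series of [t coth t], expressed with even zeta values. *)
Definition coth_series : fps R := fun n =>
  if odd n then 0 else if n is 0 then 1
  else - (2 * (-1) ^+ n./2 * zeta n%:R / pi ^+ n).

Lemma coth_seriesE k :
  coth_series (2 * k.+1)%N =
  2 * (-1) ^+ k * zeta (2 * k.+1)%:R / pi ^+ (2 * k.+1).
Proof.
have od : odd (2 * k.+1) = false by rewrite oddM.
have hf : (2 * k.+1)./2 = k.+1 by rewrite mul2n doubleK.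
move: od hf; case E : (2 * k.+1)%N => [|n] // od hf.
by rewrite /coth_series od hf exprS mulN1r mulrN !mulNr opprK.
Qed.

Lemma coth_series_even : fps_even coth_series.
Proof. by move=> n; rewrite /coth_series => ->. Qed.

(** [2 t coth (2 t) = t coth t + t tanh t] *)
Lemma fps_scale2_coth :
  fps_scale 2 coth_series = coth_series + fpsX * fps_tan 1 (@tan_coef R).
Proof.
apply: fpsP => -[|n]; rewrite fpsDE /fps_scale.
  by rewrite fpsXM0E mul1r addr0.
rewrite fpsXMSE; have [en|on] := boolP (odd n.+1).
  rewrite coth_series_even // fps_tan_odd ?mulr0 ?addr0 //=.
have [k ->] : exists k, n = (2 * k).+1.
  exists n./2; rewrite /= negbK in on.
  by rewrite -[LHS](odd_double_half n) on mul2n.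
rewrite fps_tanE (_ : (2 * k).+2 = 2 * k.+1)%N ?coth_seriesE; last by lia.
rewrite /tan_coef /odd_zeta exprMn exprVn [2 ^+ (2 * _)]exprM.
have -> : 2 ^+ 2 = 4 :> R by rewrite -natrX.
have pn : pi ^+ (2 * k.+1) != 0 :> R by rewrite expf_neq0 // lt0r_neq0 ?pi_gt0.
have fn : 4 ^+ k.+1 != 0 :> R by rewrite expf_neq0.
move: (pi ^+ _) (4 ^+ _) (zeta _) ((-1) ^+ k) pn fn => P F Z E P0 F0.
by field; rewrite P0 F0.
Qed.

End EvenZetaSeries.

(** * Real parts of powers of a complex number *)

Section PolynomialRecurrence.
Variable R : realType.
Variables (x a : R).
Let z : R[i] := (x +i* a)%C.

Lemma Re_exprS n : complex.Re (z ^+ n.+1) =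
  x * complex.Re (z ^+ n) - a * complex.Im (z ^+ n).
Proof. by rewrite exprS; case: (z ^+ n). Qed.

Lemma Im_exprS n : complex.Im (z ^+ n.+1) =
  x * complex.Im (z ^+ n) + a * complex.Re (z ^+ n).
Proof. by rewrite exprS; case: (z ^+ n). Qed.

(** [exp (x t) (cos (a t) + i sin (a t)) = exp ((x + i a) t)] *)
Lemma fps_exp_cis n :
  (fps_exp x * fps_scale a (fps_cos (-1))) n = complex.Re (z ^+ n) / n`!%:R /\
  (fps_exp x * fps_scale a (fps_sin (-1))) n = complex.Im (z ^+ n) / n`!%:R.
Proof.
set F := fps_exp x * _; set G := fps_exp x * _.
have DF : fpsD F = fpsC x * F - fpsC a * G.
  rewrite /F /G fpsDM fpsD_exp fpsDscale fpsD_cos fps_scaleM fps_scaleC fpsCN1.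
  by ring.
have DG : fpsD G = fpsC x * G + fpsC a * F.
  rewrite /F /G fpsDM fpsD_exp fpsDscale fpsD_sin; ring.
elim: n => [|n [IHF IHG]].
  rewrite /F /G !fpsM0E /fps_scale fps_cos0E fps_sin0E /fps_exp !expr0 fact0 /=.
  by split; field.
have := congr1 (fun f : fps R => f n) DF.
have := congr1 (fun f : fps R => f n) DG.
rewrite !fpsDE fpsNE !fpsCME IHF IHG /fpsD Re_exprS Im_exprS factS natrM.
have n0 : n.+1%:R != 0 :> R by rewrite pnatr_eq0.
have f0 := fact_neq0 R n.
move: n.+1%:R n0 n`!%:R f0 => N N0 f f0 EG EF.
by split; apply: (mulfI N0); rewrite ?EF ?EG; field; rewrite N0 f0.
Qed.

(** [t k * (2 k + 1)!] is the [k]-th tangent number. *)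
Lemma sqr_Re_expr t j : tan_recurrence t ->
  x ^+ 2 * complex.Re (z ^+ j) = complex.Re (z ^+ j.+2)
  + \sum_(0 <= k < j./2.+1) 2 * a ^+ (2 * k.+1) * (t k * (2 * k).+1`!%:R)
      * 'C(j.+1, j - 2 * k)%:R * complex.Re (z ^+ (j - 2 * k))
  - a ^+ 2 * complex.Re (z ^+ j).
Proof.
move=> tr; have := fps_exp_cos_eq x a tr => /=.
set F := fps_exp x * _ => FE; have FC n : F n = complex.Re (z ^+ n) / n`!%:R.
  by have [] := fps_exp_cis n.
have := congr1 (fun f : fps R => f j) FE.
rewrite !fpsDE fpsNE !fpsCME /fpsD fps_oddME; last first.
  by move=> n en; rewrite /fps_scale fps_tan_odd ?mulr0.
have TE k : fps_scale a (fps_tan (-1) t) (2 * k).+1 = a ^+ (2 * k).+1 * t k.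
  by rewrite /fps_scale fps_tanE opprK expr1n mul1r.
rewrite (eq_bigr (fun k => a ^+ (2 * k).+1 * t k *
  (complex.Re (z ^+ (j - 2 * k)) / (j - 2 * k)`!%:R))); last first.
  by move=> k _; rewrite TE FC.
rewrite !FC => E.
have j0 := fact_neq0 R j.
transitivity (x ^+ 2 * (complex.Re (z ^+ j) / j`!%:R) * j`!%:R); first by field.
rewrite E [LHS]mulrBl [X in X - _]mulrDl; congr (_ + _ - _); last by field.
  rewrite !factS !natrM.
  have h1 : j.+1%:R != 0 :> R by rewrite pnatr_eq0.
  have h2 : j.+2%:R != 0 :> R by rewrite pnatr_eq0.
  by move: j.+1%:R j.+2%:R h1 h2 => u v u0 v0; field; rewrite u0 v0 j0.
rewrite !mulr_sumr mulr_suml; apply: eq_big_nat => k /andP[_ kj].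
have kj' : (2 * k <= j)%N.
  have := odd_double_half j; rewrite -mul2n; lia.
have B : 'C(j.+1, j - 2 * k)%:R * ((j - 2 * k)`!%:R * (2 * k).+1`!%:R) =
    j.+1%:R * j`!%:R :> R.
  rewrite -!natrM -factS -(@bin_fact j.+1 (j - 2 * k)); last by lia.
  by congr ((_ * (_ * _`!))%:R); lia.
have b0 := fact_neq0 R (j - 2 * k).
rewrite mulnS add2n !exprS.
move: (a ^+ (2 * k)) => A.
apply: (mulIf b0).
transitivity (2 * a * a * A * t k * complex.Re (z ^+ (j - 2 * k))
  * (j.+1%:R * j`!%:R)).
  by move: j.+1%:R b0 => u b0; field.
by rewrite -B; ring.
Qed.

End PolynomialRecurrence.

(** * Derivatives of the hyperbolic secant *)

Section SechDerivatives.
Variable R : realType.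
Implicit Types x : R.

(** Hyperbolic cosine and sine. *)
Definition cosh x : R := (expR x + expR (- x)) / 2.
Definition sinh x : R := (expR x - expR (- x)) / 2.

Lemma cosh_gt0 x : 0 < cosh x.
Proof. by rewrite divr_gt0 // addr_gt0 ?expR_gt0. Qed.

Lemma cosh2B x : cosh x ^+ 2 - sinh x ^+ 2 = 1.
Proof.
have e : expR x * expR (- x) = 1 by rewrite -expRD subrr expR0.
by rewrite /cosh /sinh -[RHS]e; field.
Qed.

Lemma sechE x : sech x = (cosh x)^-1.
Proof. by rewrite /sech /cosh invf_div. Qed.

Lemma tanhE x : tanh x = sinh x / cosh x.
Proof.
have e0 : expR x + expR (- x) != 0 by rewrite lt0r_neq0 // addr_gt0 ?expR_gt0.
by rewrite /tanh /sinh /cosh; field.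
Qed.

Lemma sech_neq0 x : sech x != 0.
Proof. by rewrite sechE invr_eq0 lt0r_neq0 // cosh_gt0. Qed.

Lemma tanh2 x : tanh x ^+ 2 = 1 - sech x ^+ 2.
Proof.
have c0 := lt0r_neq0 (cosh_gt0 x).
rewrite tanhE sechE -[X in X - _](@mulfV _ (cosh x ^+ 2)) ?expf_neq0 //.
by rewrite -{1}[cosh x ^+ 2](subrK (sinh x ^+ 2)) cosh2B; field.
Qed.

Lemma is_derive_expRN x :
  is_derive x (1 : R) (fun y => expR (- y)) (- expR (- x)).
Proof.
have h : is_derive x (1 : R) (expR \o -%R) (expR (- x) * -1).
  by apply: is_derive1_comp.
by apply: is_derive_eq h _; rewrite mulrN1.
Qed.

Lemma is_derive_cosh x : is_derive x (1 : R) cosh (sinh x).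
Proof.
have h := is_derive_expRN x.
rewrite /cosh /sinh; apply: is_derive_eq; rewrite /GRing.scale /=; ring.
Qed.

Lemma is_derive_sinh x : is_derive x (1 : R) sinh (cosh x).
Proof.
have h := is_derive_expRN x.
rewrite /cosh /sinh; apply: is_derive_eq; rewrite /GRing.scale /=; ring.
Qed.

Lemma is_derive_sech x : is_derive x (1 : R) sech (- (sech x * tanh x)).
Proof.
have c0 := lt0r_neq0 (cosh_gt0 x).
have <- : (fun y => (cosh y)^-1) = sech by apply/funext => y; rewrite sechE.
apply: (is_derive_eq (is_deriveV c0 (is_derive_cosh x))).
by rewrite tanhE /GRing.scale /=; field.
Qed.

Lemma is_derive_tanh x : is_derive x (1 : R) tanh (sech x ^+ 2).
Proof.
have c0 := lt0r_neq0 (cosh_gt0 x).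
have <- : (fun y => sinh y * (cosh y)^-1) = tanh.
  by apply/funext => y; rewrite tanhE.
apply: (is_derive_eq (is_deriveM (is_derive_sinh x)
  (is_deriveV c0 (is_derive_cosh x)))).
rewrite /GRing.scale /= sechE.
transitivity ((cosh x ^+ 2 - sinh x ^+ 2) / cosh x ^+ 2); first by field.
by rewrite cosh2B; field.
Qed.

(** Derivatives of [sech * P (sech^2)] and [sech * tanh * P (sech^2)], which
    alternate along the iterated derivatives of the hyperbolic secant. *)
Lemma is_derive_sech_poly (P : {poly R}) x :
  is_derive x (1 : R) (fun y => sech y * P.[sech y ^+ 2])
    (sech x * tanh x * (- (P + 2%:P * 'X * P^`())).[sech x ^+ 2]).
Proof.
have h := is_derive_sech x.
have h2 : is_derive x (1 : R) (horner P \o (fun y => sech y ^+ 2))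
    (P^`().[sech x ^+ 2] * (2 * sech x * - (sech x * tanh x))).
  apply: is_derive1_comp.
  by apply: is_derive_eq; rewrite /GRing.scale /=; ring.
apply: (is_derive_eq (is_deriveM h h2)).
rewrite /GRing.scale /=; move: (sech x) (tanh x) => s u.
by rewrite !(hornerD, hornerN, hornerM, hornerC, hornerX); ring.
Qed.

Lemma is_derive_sech_tanh_poly (P : {poly R}) x :
  is_derive x (1 : R) (fun y => sech y * tanh y * P.[sech y ^+ 2])
    (sech x *
     ((2%:P * 'X - 1) * P - 2%:P * 'X * (1 - 'X) * P^`()).[sech x ^+ 2]).
Proof.
have h := is_derive_sech x; have ht := is_derive_tanh x.
have h2 : is_derive x (1 : R) (horner P \o (fun y => sech y ^+ 2))
    (P^`().[sech x ^+ 2] * (2 * sech x * - (sech x * tanh x))).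
  apply: is_derive1_comp.
  by apply: is_derive_eq; rewrite /GRing.scale /=; ring.
apply: (is_derive_eq (is_deriveM (is_deriveM h ht) h2)).
rewrite /GRing.scale /= -[(sech * tanh) x]/(sech x * tanh x).
move: (sech x) (tanh x) (tanh2 x) => s u u2.
transitivity (s * ((s ^+ 2 - u ^+ 2) * P.[s ^+ 2]
  - 2 * s ^+ 2 * u ^+ 2 * P^`().[s ^+ 2])); first by ring.
by rewrite u2 !(hornerD, hornerN, hornerM, hornerC, hornerX); ring.
Qed.

Lemma derive1n_sech_even m : exists P : {poly R},
  derive1n (2 * m) sech = (fun x : R => sech x * P.[sech x ^+ 2]).
Proof.
elim: m => [|m [P IH]].
  by exists 1; apply/funext => x; rewrite muln0 derive1n0 hornerC mulr1.
pose Q : {poly R} := - (P + 2%:P * 'X * P^`()).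
exists ((2%:P * 'X - 1) * Q - 2%:P * 'X * (1 - 'X) * Q^`()).
rewrite mulnS add2n !derive1nS IH.
have -> : derive1 (fun x : R => sech x * P.[sech x ^+ 2]) =
          (fun x => sech x * tanh x * Q.[sech x ^+ 2]).
  apply/funext => x; rewrite derive1E.
  exact: (@derive_val _ _ _ _ _ _ _ (is_derive_sech_poly P x)).
apply/funext => x; rewrite derive1E.
exact: (@derive_val _ _ _ _ _ _ _ (is_derive_sech_tanh_poly Q x)).
Qed.

Lemma derive1n_sech_odd m : exists P : {poly R},
  derive1n (2 * m).+1 sech = (fun x : R => sech x * tanh x * P.[sech x ^+ 2]).
Proof.
have [P E] := derive1n_sech_even m.
exists (- (P + 2%:P * 'X * P^`())); rewrite derive1nS E.
apply/funext => x; rewrite derive1E.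
exact: (@derive_val _ _ _ _ _ _ _ (is_derive_sech_poly P x)).
Qed.

Lemma is_derive_derive1n_sech n x :
  is_derive x (1 : R) (derive1n n sech) (derive1n n.+1 sech x).
Proof.
rewrite derive1nS derive1E; apply: DeriveDef => //.
rewrite -[n](odd_double_half n) -mul2n.
case: (odd n).
  rewrite add1n; have [P ->] := derive1n_sech_odd n./2.
  exact: (@ex_derive _ _ _ _ _ _ _ (is_derive_sech_tanh_poly P x)).
rewrite add0n; have [P ->] := derive1n_sech_even n./2.
exact: (@ex_derive _ _ _ _ _ _ _ (is_derive_sech_poly P x)).
Qed.

(** Taylor series at [x] of the hyperbolic secant and cosine. *)
Definition taylor_sech x : fps R := fun n => derive1n n sech x / n`!%:R.

Definition taylor_cosh x : fps R :=
  fpsC (cosh x) * fps_cos 1 + fpsC (sinh x) * fps_sin 1.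

Lemma is_derive_taylor_sech n x : is_derive x (1 : R)
  (fun y => taylor_sech y n) (fpsD (taylor_sech x) n).
Proof.
have h := is_derive_derive1n_sech n x.
apply: is_derive_eq; rewrite /fpsD /taylor_sech /GRing.scale /=.
rewrite -(fact_invS R n); ring.
Qed.

Lemma is_derive_taylor_cosh n x : is_derive x (1 : R)
  (fun y => taylor_cosh y n) (fpsD (taylor_cosh x) n).
Proof.
have hc := is_derive_cosh x; have hs := is_derive_sinh x.
have -> : (fun y => taylor_cosh y n) =
    (fun y => cosh y * fps_cos 1 n + sinh y * fps_sin 1 n).
  by apply/funext => y; rewrite /taylor_cosh fpsDE !fpsCME.
apply: is_derive_eq.
rewrite /taylor_cosh fpsDD !fpsDM !fpsDC fpsD_cos fpsD_sin fpsC1 mul1r !mul0r.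
rewrite !add0r fpsDE !fpsCME /GRing.scale /=; ring.
Qed.

(** By the Leibniz rule, the product of the two Taylor series is that of the
    constant function one. *)
Lemma taylor_sech_cosh x : taylor_sech x * taylor_cosh x = 1.
Proof.
pose W (y : R) := taylor_sech y * taylor_cosh y.
have dW n y : is_derive y (1 : R) (fun v => W v n) (fpsD (W y) n).
  have -> : (fun v => W v n) = \sum_(i < n.+1)
     ((fun v => taylor_sech v i) * (fun v => taylor_cosh v (n - i)%N)).
    by apply/funext => v; rewrite fct_sumE.
  have hu i := is_derive_taylor_sech i y.
  have hv i := is_derive_taylor_cosh i y.
  apply: is_derive_eq; rewrite fpsDM fpsDE !fpsME -big_split.
  by apply: eq_bigr => i _; rewrite /GRing.scale /=; ring.
suff WE n : forall y, W y n = (n == 0%N)%:R by apply: fpsP => n; exact: WE.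
elim: n => [|n IHn] y.
  rewrite /W fpsM0E /taylor_sech /taylor_cosh fpsDE !fpsCME fps_cos0E fps_sin0E.
  rewrite mulr0 addr0 mulr1 derive1n0 fact0 divr1 sechE mulVf //.
  exact/lt0r_neq0/cosh_gt0.
have E : (fun v => W v n) = cst ((n == 0%N)%:R).
  by apply/funext => v; rewrite IHn.
have := @derive_val _ _ _ _ _ _ _ (dW n y); rewrite E derive_cst => /esym/eqP.
by rewrite mulf_eq0 pnatr_eq0 /= => /eqP.
Qed.

End SechDerivatives.

(** * The polynomials [p] *)

Section PolynomialP.
Variable R : realType.

Lemma Re_Im_expr_even (a : R) m : exists P Q : {poly R}, forall x : R,
  let z : R[i] := (x +i* a)%C in
  complex.Re (z ^+ (2 * m)) = P.[x ^+ 2] /\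
  complex.Im (z ^+ (2 * m)) = x * Q.[x ^+ 2].
Proof.
elim: m => [|m [P [Q PQ]]].
  by exists 1, 0 => x z; rewrite muln0 expr0 hornerC horner0 mulr0.
exists (('X - (a ^+ 2)%:P) * P - (2 * a)%:P * 'X * Q).
exists (('X - (a ^+ 2)%:P) * Q + (2 * a)%:P * P) => x z.
have [Re Im] := PQ x.
rewrite mulnS add2n !Re_exprS !Im_exprS !Re_exprS Re Im.
rewrite !(hornerD, hornerN, hornerM, hornerC, hornerX).
by split; ring.
Qed.

Lemma p_even_poly d m : ~~ odd d ->
  exists P : {poly R}, forall x : R, p d m x = P.[x ^+ 2].
Proof.
move=> /negPf ed; have [P [Q PQ]] := Re_Im_expr_even (pi / 2) m.
by exists P => x; rewrite /p ed; have [-> _] := PQ x.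
Qed.

Lemma p_odd_poly d m : odd d ->
  exists P : {poly R}, forall x : R, p d m x = x * P.[x ^+ 2].
Proof.
move=> od; have [P [Q PQ]] := Re_Im_expr_even (pi / 2) m.
exists (P - (pi / 2)%:P * Q) => x; rewrite /p od Re_exprS.
have [-> ->] := PQ x.
rewrite !(hornerD, hornerN, hornerM, hornerC); ring.
Qed.

Lemma tangent_numberE k : tangent_number k = tan_coef R k * (2 * k).+1`!%:R.
Proof.
rewrite /tangent_number /tan_coef /odd_zeta.
have -> : (2 * k + 2 = 2 * k.+1)%N by rewrite mulnS addnC.
have -> : (2 : R) ^+ (2 * k.+1) = 4 ^+ k.+1 by rewrite exprM -natrX.
by ring.
Qed.

Lemma pE d m (x : R) :
  p d m x = complex.Re ((x +i* (pi / 2))%C ^+ (2 * m + odd d)).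
Proof. by rewrite /p; case: (odd d); rewrite ?addn1 ?addn0. Qed.

(** The formula that defines [alpha d k m] for [2 <= k] also holds for [k = 1],
    up to the additional term [- (pi / 2)^2]. *)
Lemma alphaS d k m : (k <= m)%N -> let j := (2 * m + odd d)%N in
  alpha d k.+1 m =
  2 * (pi / 2) ^+ (2 * k.+1) * (tan_coef R k * (2 * k).+1`!%:R)
    * 'C(j.+1, j - 2 * k)%:R
  - (if k == 0%N then (pi / 2) ^+ 2 else 0).
Proof.
move=> km j; case: k km => [_|k km].
  have [t0 _] := tan_coef_recurrence R.
  rewrite /alpha t0 muln0 -[1%N`!]/1%N muln1 subn0 eqxx.
  have -> : 'C(j.+1, j) = j.+1 by rewrite -bin_sub // subSnn bin1.
  have -> : (if odd d then 4 * m + 3 else 4 * m + 1)%N = (2 * j + 1)%N.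
    by rewrite /j; case: (odd d); lia.
  by rewrite natrD natrM -natr1; ring.
rewrite /alpha -[k.+2.-1]/k.+1 tangent_numberE subr0.
have -> : (if odd d then 'C(2 * m + 2, 2 * (m.+1 - k.+2) + 1)
           else 'C(2 * m + 1, 2 * (m.+1 - k.+2))) = 'C(j.+1, j - 2 * k.+1).
  rewrite /j; case: (odd d); congr 'C(_, _); lia.
by ring.
Qed.

Lemma p_recurrence d m (x : R) :
  x ^+ 2 * p d m x = \sum_(0 <= k < m.+2) alpha d k m * p d (m.+1 - k) x.
Proof.
pose j := (2 * m + odd d)%N.
have jm : j./2 = m by rewrite /j mul2n addnC half_bit_double.
rewrite pE (sqr_Re_expr x (pi / 2) j (tan_coef_recurrence R)) -/j jm.
rewrite [RHS]big_nat_recl // subn0 -[alpha d 0 m]/1 mul1r pE.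
have -> : (2 * m.+1 + odd d = j.+2)%N by rewrite mulnS.
rewrite -addrA; congr (_ + _).
have -> : (pi / 2) ^+ 2 * complex.Re ((x +i* (pi / 2))%C ^+ j) =
  \sum_(0 <= k < m.+1) (if k == 0%N then (pi / 2) ^+ 2 else 0)
     * complex.Re ((x +i* (pi / 2))%C ^+ (j - 2 * k)).
  rewrite big_nat_recl //= muln0 subn0 big1 ?addr0 // => k _.
  by rewrite mul0r.
rewrite -sumrB; apply: eq_big_nat => k /andP[_ km].
rewrite -mulrBl alphaS // subSS pE; congr (_ * complex.Re (_ ^+ _)).
rewrite /j; lia.
Qed.

End PolynomialP.

(** * The functions [q] *)

Section SechQ.
Variable R : realType.

Lemma q_even_poly d m : ~~ odd d -> exists P : {poly R}, forall x : R,
  q d m x / sech x = P.[sech x ^+ 2].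
Proof.
move=> /negPf ed; have [P PE] := derive1n_sech_even R m.
exists ((2 / pi * (1 / (2 * m)`!%:R))%:P * P) => x.
rewrite /q ed PE hornerM hornerC; have s0 := sech_neq0 x.
by apply: (mulIf s0); rewrite divfK //; ring.
Qed.

Lemma q_odd_poly d m : odd d -> exists P : {poly R}, forall x : R,
  q d m x = sech x * tanh x * P.[sech x ^+ 2].
Proof.
move=> od; have [P PE] := derive1n_sech_odd R m.
exists ((2 / pi * (- 1 / (2 * m).+1`!%:R))%:P * P) => x.
by rewrite /q od PE hornerM hornerC; ring.
Qed.

(** The sign is [1] for even [d] and [-1] for odd [d]. *)
Lemma qE d m (x : R) :
  q d m x = 2 / pi * (-1) ^+ odd d * taylor_sech x (2 * m + odd d)%N.
Proof.
rewrite /q /taylor_sech; case: (odd d); rewrite ?addn1 ?addn0 /=; ring.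
Qed.

Lemma coefXD (f : fps R) n : (fpsX * fpsD f) n = n%:R * f n.
Proof. by case: n => [|n]; rewrite ?fpsXM0E ?mul0r // fpsXMSE. Qed.

Lemma fps_csch_even : fps_even (fps_csch (coth_series R)).
Proof.
move=> n on; rewrite /fps_csch fpsDE fpsNE fpsCME /fps_scale.
by rewrite coth_series_even // !mulr0 subr0.
Qed.

(** Coefficient of degree [j + 2] in [fps_sech_eq]. *)
Lemma taylor_sech_rec j (x : R) :
  sech x ^+ 2 * taylor_sech x j =
  - (\sum_(0 <= k < j./2.+2)
      (1 - (2 * k)%:R) * coth_series R (2 * k)%N
      * taylor_sech x (j.+2 - 2 * k)%N)
  + taylor_sech x 0%N * ((1 - j.+2%:R) * fps_csch (coth_series R) j.+2)
  + taylor_sech x 1%N * fps_csch (coth_series R) j.+1.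
Proof.
have c0 := lt0r_neq0 (cosh_gt0 x).
have := fps_sech_eq (tan_coef_recurrence R) (erefl : coth_series R 0%N = 1)
  (fps_scale2_coth R) c0 (cosh2B x) (taylor_sech_cosh x).
move=> /(congr1 (fun f : fps R => f j.+2)).
rewrite fpsCME 2!fpsXMSE -sechE => ->.
have Lev : fps_even (coth_series R - fpsX * fpsD (coth_series R)).
  by move=> n on; rewrite fpsDE fpsNE coefXD coth_series_even // mulr0 subr0.
rewrite !fpsDE !fpsNE !fpsCME fpsXMSE fps_evenME //.
have u0 : taylor_sech x 0%N = sech x.
  by rewrite /taylor_sech derive1n0 fact0 divr1.
have u1 : taylor_sech x 1%N = - (sinh x / cosh x ^+ 2).
  rewrite /taylor_sech divr1 derive1n1 derive1E.
  rewrite (@derive_val _ _ _ _ _ _ _ (is_derive_sech x)) tanhE sechE.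
  by field.
rewrite u0 u1 mulNr fpsDE fpsNE coefXD; congr (- _ + _ - _); last by ring.
apply: eq_bigr => k _; rewrite fpsDE fpsNE coefXD; ring.
Qed.

Lemma csch_coef n : fps_csch (coth_series R) (2 * n)%N =
  (2 / 4 ^+ n - 1) * coth_series R (2 * n)%N.
Proof.
rewrite /fps_csch fpsDE fpsNE fpsCME /fps_scale exprVn exprM.
have -> : (2 : R) ^+ 2 = 4 by rewrite -natrX.
by ring.
Qed.

(** The last coefficient [beta d m.+1 m] also collects the term of
    [taylor_sech_rec] in [taylor_sech x 0] if [d] is even, in [taylor_sech x 1]
    if [d] is odd. *)
Lemma betaS d k m : (k <= m)%N ->
  (-1) ^+ k * beta d k.+1 m =
  - ((1 - (2 * k.+1)%:R) * coth_series R (2 * k.+1)%N)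
  + (if k == m then
       (if odd d then 1 else 1 - (2 * m.+1)%:R) *
       fps_csch (coth_series R) (2 * m.+1)%N
     else 0).
Proof.
rewrite csch_coef !coth_seriesE /beta => km.
have p0 : pi != 0 :> R by rewrite lt0r_neq0 ?pi_gt0.
have pn n : pi ^+ n != 0 :> R by rewrite expf_neq0.
have [->|nkm] := eqVneq k m.
  rewrite ltnn (_ : 2 * m + 2 = 2 * m.+1)%N; last by lia.
  have -> : (2 : R) ^- (2 * m.+1) = (4 ^+ m.+1)^-1.
    by rewrite exprM -natrX.
  have f0 : 4 ^+ m.+1 != 0 :> R by rewrite expf_neq0.
  move: (pn (2 * m.+1)%N) f0.
  move: (pi ^+ (2 * m.+1)) (4 ^+ m.+1) (zeta _) ((-1) ^+ m) => P F Z S P0 F0.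
  by case: (odd d); rewrite natrM -[m.+1%:R]natr1 /=; field; rewrite P0 F0.
rewrite ltn_neqAle nkm km addr0 /=.
move: (pn (2 * k.+1)%N).
move: (pi ^+ (2 * k.+1)) (zeta _) ((-1) ^+ k) => P Z S P0.
rewrite natrM.
by field.
Qed.

Lemma q_recurrence d m (x : R) :
  sech x ^+ 2 * q d m x =
  \sum_(0 <= k < m.+2) (-1) ^ (k%:Z - 1) * beta d k m * q d (m.+1 - k) x.
Proof.
pose j := (2 * m + odd d)%N; pose u := taylor_sech x.
have jm : j./2 = m by rewrite /j mul2n addnC half_bit_double.
suff E : sech x ^+ 2 * u j = \sum_(0 <= k < m.+2)
    (-1) ^ (k%:Z - 1) * beta d k m * u (j.+2 - 2 * k)%N.
  rewrite qE -/j mulrCA E !mulr_sumr; apply: eq_big_nat => k /andP[_ km].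
  rewrite qE -/u.
  have -> : (2 * (m.+1 - k) + odd d = j.+2 - 2 * k)%N by rewrite /j; lia.
  by ring.
rewrite taylor_sech_rec jm big_nat_recl // [in RHS]big_nat_recl //.
have L0 : coth_series R 0%N = 1 by [].
rewrite muln0 subn0 subr0 L0 !mul1r -[beta d 0 m]/1 mulr1.
have -> : (-1) ^ (0%:Z - 1) = -1 :> R by rewrite sub0r -invr_expz expr1z invrN1.
rewrite mulN1r opprD -!addrA; congr (_ + _).
transitivity (\sum_(0 <= k < m.+1)
  (- ((1 - (2 * k.+1)%:R) * coth_series R (2 * k.+1)%N * u (j.+2 - 2 * k.+1)%N)
   + (if k == m then (if odd d then 1 else 1 - (2 * m.+1)%:R) *
       fps_csch (coth_series R) (2 * m.+1)%N * u (j.+2 - 2 * k.+1)%N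
     else 0))); last first.
  apply: eq_big_nat => k /andP[_ km].
  have -> : (k.+1%:Z - 1 = k%:Z)%R by lia.
  rewrite -[_ ^ k%:Z]/(_ ^+ k) betaS // [RHS]mulrDl mulNr.
  by case: eqP; rewrite ?mul0r.
rewrite big_split sumrN; congr (_ + _).
rewrite big_nat_recr //= eqxx big_nat big1 ?add0r; last first.
  by move=> k /andP[_ km]; rewrite ltn_eqF.
rewrite /u /j; case: (odd d); rewrite ?addn1 ?addn0.
  rewrite fps_csch_even; last by rewrite /= oddM.
  by rewrite !mulr0 add0r mul1r mulnS add2n subSn // subnn mulrC.
rewrite [fps_csch _ (2 * m).+1]fps_csch_even; last by rewrite /= oddM.
by rewrite mulr0 addr0 mulnS add2n subnn mulrC.
Qed.

Lemma zeta2 : zeta (2 * 1)%:R = pi ^+ 2 / 6 :> R.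
Proof. by have := odd_zeta1 R; rewrite /odd_zeta expr1; lra. Qed.

Lemma zeta_even_bound k : (0 < k)%N ->
  0 <= (zeta (2 * k)%:R : R) <= pi ^+ 2 / 6.
Proof.
move=> k0; have ck := @cvg_zeta_sum R k k0; have c1 := @cvg_zeta_sum R 1 isT.
apply/andP; split.
  apply: (cvgr_to_ge ck); near=> N.
  by apply: sumr_ge0 => a _; rewrite invr_ge0 exprn_ge0 // ler0n.
rewrite -zeta2; apply: (ler_cvg_to ck c1); near=> N.
apply: ler_sum => a _; rewrite lef_pV2 ?posrE ?exprn_gt0 ?ltr0n //.
by apply: ler_weXn2l; rewrite ?ler1n // leq_mul2l.
Unshelve. all: by end_near.
Qed.

(** Since [pi >= 2] and [zeta (2 k) <= zeta 2]. *)
Lemma zeta_even_ratio k :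
  0 <= zeta (2 * k.+1)%:R / (pi : R) ^+ (2 * k.+1) <= (6 * 4 ^+ k)^-1.
Proof.
have /andP[z0 z1] := zeta_even_bound (ltn0Sn k).
have p0 := pi_gt0 R.
have P0 : 0 < pi ^+ (2 * k.+1) :> R by rewrite exprn_gt0.
rewrite divr_ge0 ?(ltW P0) //= ler_pdivrMr //; apply: le_trans z1 _.
have f0 : 0 < 4 ^+ k :> R by rewrite exprn_gt0.
have le : 4 ^+ k <= (pi ^+ 2) ^+ k :> R.
  apply: lerXn2r; rewrite ?nnegrE ?exprn_ge0 ?(ltW p0) //.
  by have := pi_ge2 R; move: (pi : R) => P P2; nra.
rewrite exprM [(pi ^+ 2) ^+ k.+1]exprS -(ler_pM2l f0).
rewrite [leRHS](_ : _ = pi ^+ 2 / 6 * (pi ^+ 2) ^+ k).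
  by rewrite mulrC ler_wpM2l // divr_ge0 ?exprn_ge0 ?(ltW p0).
by move: (pi ^+ 2) (_ ^+ k) (4 ^+ k) (lt0r_neq0 f0) => P Q F F0; field.
Qed.

Lemma linear_le_expr4 k : (2 * k%:R + 1 : R) <= 4 ^+ k.
Proof.
elim: k => [|k IHk]; first by rewrite mulr0 add0r expr0.
by rewrite exprS -natr1; have := ler0n R k; lra.
Qed.

Lemma beta_bound d k m : (k <= m.+1)%N -> 0 <= (beta d k m : R) <= 1.
Proof.
case: k => [_|k km]; first by rewrite /beta ler01 lexx.
have /andP[r0 r1] := zeta_even_ratio k.
have lk := linear_le_expr4 k; have k0 := ler0n R k.
have f0 : 0 < 4 ^+ k :> R by rewrite exprn_gt0.
have R1 : (2 * k%:R + 1) * (zeta (2 * k.+1)%:R / pi ^+ (2 * k.+1)) <= 6^-1 :> R.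
  have k1 : 0 <= 2 * k%:R + 1 :> R by lra.
  apply: le_trans (ler_pM k1 r0 lk r1) _.
  by rewrite invfM mulrCA mulfV ?mulr1 ?lt0r_neq0.
have R0 : 0 <= (2 * k%:R + 1) * (zeta (2 * k.+1)%:R / pi ^+ (2 * k.+1)) :> R.
  by rewrite mulr_ge0 //; lra.
rewrite /beta /=; case: ltnP => [km'|mk].
  have -> : 2 * (2 * k.+1%:R - 1) / pi ^+ (2 * k.+1) * zeta (2 * k.+1)%:R =
     2 * ((2 * k%:R + 1) * (zeta (2 * k.+1)%:R / pi ^+ (2 * k.+1))) :> R.
    by rewrite -natr1; ring.
  by apply/andP; split; lra.
have <- : k = m by lia.
have -> : (2 * k + 2 = 2 * k.+1)%N by lia.
have -> : (2 : R) ^- (2 * k.+1) = (4 ^+ k.+1)^-1 by rewrite exprM -natrX.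
have v0 : 0 <= (4 ^+ k.+1)^-1 :> R by rewrite invr_ge0 exprn_ge0.
have v1 : (4 ^+ k.+1)^-1 <= 4^-1 :> R.
  rewrite lef_pV2 ?posrE ?exprn_gt0 // exprS.
  have q1 : 1 <= 4 ^+ k :> R by rewrite exprn_ege1 // ler1n.
  by lra.
rewrite -[4 * _ / _]mulrA.
move: (zeta _ / _) (4 ^+ k.+1)^-1 r0 R0 R1 v0 v1 => r v r0 R0 R1 v0 v1.
have rk : 0 <= r * k%:R by rewrite mulr_ge0.
have rv : 0 <= r * v by rewrite mulr_ge0.
have rv1 : 0 <= r * (1 - v) by rewrite mulr_ge0 //; lra.
have wv : 0 <= (2 * k%:R + 1) * r * v by rewrite mulr_ge0.
have wv1 : 0 <= (2 * k%:R + 1) * r * (1 - v) by rewrite mulr_ge0 //; lra.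
by case: (odd d); apply/andP; split; lra.
Qed.

End SechQ.

Unset Implicit Arguments.

Theorem lemma4p4 (R : realType) (d : nat) (hd : (2 <= d)%N) (m : nat) :
  ((~~ odd d -> exists P : {poly R}, forall x : R, p d m x = P.[x ^+ 2]) /\
   (odd d -> exists P : {poly R}, forall x : R, p d m x = x * P.[x ^+ 2]) /\
   (forall x : R,
      x ^+ 2 * p d m x
      = \sum_(0 <= k < m.+2) alpha d k m * p d (m.+1 - k) x))
  /\
  ((~~ odd d -> exists P : {poly R}, forall x : R,
      q d m x / sech x = P.[sech x ^+ 2]) /\
   (odd d -> exists P : {poly R}, forall x : R,
      q d m x = sech x * tanh x * P.[sech x ^+ 2]) /\
   (forall x : R,
      sech x ^+ 2 * q d m x
      = \sum_(0 <= k < m.+2)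
          (-1) ^ (k%:Z - 1) * beta d k m * q d (m.+1 - k) x) /\
   (forall k : nat, (k <= m.+1)%N -> 0 <= (beta d k m : R) <= 1)).
Proof.
split; (split; [|split]).
- exact: p_even_poly.
- exact: p_odd_poly.
- exact: p_recurrence.
- exact: q_even_poly.
- exact: q_odd_poly.
- by split; [exact: q_recurrence | move=> k; exact: beta_bound].
Qed.
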